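(* Let $n\ge1$ and let $f:\mathbb{R}\to\mathbb{R}$ be a discontinuous $n$-monomial function. Let $\Gamma_f$ be the closure in $\mathbb{R}^2$ of the graph $G(f)=\{(x,f(x)):x\in\mathbb{R}\}$, and let $\Omega_f$ be the interior of $\Gamma_f$. Then $G(f)$ is connected if and only if $G(f)\cap K\neq\emptyset$ for every continuum $K\subseteq\Omega_f$ which touches two distinct vertical lines.
   Context: For $h\in\mathbb{R}$, $\Delta_h f(x)=f(x+h)-f(x)$ and $\Delta_h^{n}=\Delta_h\circ\Delta_h^{n-1}$. A function $f:\mathbb{R}\to\mathbb{R}$ is an $n$-monomial function if $\frac{1}{n!}\Delta_h^n f(x)=f(h)$ for all $x,h\in\mathbb{R}$. A continuum is a compact connected subset of $\mathbb{R}^2$ containing more than one point. A set $K\subseteq\mathbb{R}^2$ touches two distinct vertical lines if it contains points $(x_0,y_0),(x_1,y_1)$ with $x_0\neq x_1$. *)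

(* Defs.v *)
From Stdlib Require Import Reals List Arith Factorial.
Open Scope R_scope.

Definition Delta (h : R) (f : R -> R) : R -> R := fun x => f (x + h) - f x.
Fixpoint Delta_n (n : nat) (h : R) (f : R -> R) : R -> R :=
  match n with
  | O => f
  | S m => Delta h (Delta_n m h f)
  end.

Definition n_monomial (n : nat) (f : R -> R) : Prop :=
  forall x h : R, / INR (fact n) * Delta_n n h f x = f h.

Definition R2 := (R * R)%type.
Definition set2 := R2 -> Prop.

Definition dist2 (p q : R2) : R :=
  sqrt ((fst p - fst q) ^ 2 + (snd p - snd q) ^ 2).

Definition open2 (U : set2) : Prop :=
  forall p, U p -> exists eps, 0 < eps /\ forall q, dist2 p q < eps -> U q.

Definition closure2 (A : set2) : set2 :=
  fun p => forall eps, 0 < eps -> exists q, A q /\ dist2 p q < eps.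

Definition interior2 (A : set2) : set2 :=
  fun p => exists eps, 0 < eps /\ forall q, dist2 p q < eps -> A q.

Definition connected2 (A : set2) : Prop :=
  ~ exists U V : set2, open2 U /\ open2 V /\
      (forall p, A p -> U p \/ V p) /\
      (exists p, A p /\ U p) /\ (exists p, A p /\ V p) /\
      (forall p, A p -> U p -> V p -> False).

Definition compact2 (K : set2) : Prop :=
  forall (I : Type) (U : I -> set2),
    (forall i, open2 (U i)) ->
    (forall p, K p -> exists i, U i p) ->
    exists l : list I, forall p, K p -> exists i, In i l /\ U i p.

Definition continuum (K : set2) : Prop :=
  compact2 K /\ connected2 K /\ exists p q, K p /\ K q /\ p <> q.

Definition touches_two_vertical_lines (K : set2) : Prop :=
  exists p q, K p /\ K q /\ fst p <> fst q.

Definition graph (f : R -> R) : set2 := fun p => snd p = f (fst p).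

(* Main.v *)
From Stdlib Require Import Reals Lra Lia ZArith List Bool Classical ClassicalEpsilon.
Require Import Defs.
Open Scope R_scope.

(** Put [g x = f x / x^n].  It is invariant under nonzero rational dilations, and since [f] agrees
    with a polynomial at the rational parameters of every line, the values of [g] are dense in
    the interval they span; discontinuity of [f] makes this interval unbounded.

    If a continuum [K] in the interior of the closure of the graph misses the graph and crosses
    a vertical strip away from [0], choose two abscissae in the strip at which the graph passes
    far above (or below) [K].  The part of the graph between them and on the other side of [K]
    is open and closed in the graph, and it is not empty because the graph is dense near [K].

    Conversely, let the graph split into two relatively open parts.  If points of both parts
    occurred over arbitrarily small neighbourhoods of some [x <> 0], there would be a rectangle
    in the region filled by the graph whose bottom is adherent to one part only and whose top to
    the other part only.  The points of the rectangle adherent to both parts then contain a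
    continuum joining its vertical sides, and this continuum misses the graph.  So the part to
    which [(x, f x)] belongs depends only on the sign of [x], and [f (q x) = q^n f x] with
    [q -> 0] links both signs to the origin. *)

(** * Iterated differences under a change of step *)

Lemma Delta_ext (h : R) (f g : R -> R) :
  (forall x, f x = g x) -> forall x, Delta h f x = Delta h g x.
Proof. intros H x; unfold Delta; now rewrite !H. Qed.

Lemma Delta_comm (h k : R) (f : R -> R) (x : R) :
  Delta h (Delta k f) x = Delta k (Delta h f) x.
Proof.
  unfold Delta.
  replace (x + h + k) with (x + k + h) by ring; ring.
Qed.

Lemma Delta_n_Delta_comm (n : nat) (h k : R) (f : R -> R) (x : R) :
  Delta_n n h (Delta k f) x = Delta k (Delta_n n h f) x.
Proof.
  revert x; induction n as [|n IH]; intro x; simpl; [reflexivity|].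
  rewrite (Delta_ext h _ _ IH x); apply Delta_comm.
Qed.

Lemma Delta_mult_const (N : nat) (h c : R) (f : R -> R) :
  (forall x, Delta h f x = c) -> forall x, Delta (INR N * h) f x = INR N * c.
Proof.
  intros H; unfold Delta in *.
  induction N as [|N IH]; intro x.
  - simpl; rewrite !Rmult_0_l, Rplus_0_r; ring.
  - rewrite S_INR.
    replace (x + (INR N + 1) * h) with ((x + h) + INR N * h) by ring.
    specialize (IH (x + h)); specialize (H x); lra.
Qed.

(** Each of the [n] differences contributes one factor [N]. The induction ranges over all [f], since
    it is applied to [Delta (INR N * h) f], whose lower difference with step [h] is again constant
    because the operators commute. *)
Lemma Delta_n_mult_const (N n : nat) (h c : R) (f : R -> R) :
  (forall x, Delta_n n h f x = c) ->
  forall x, Delta_n n (INR N * h) f x = INR N ^ n * c.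
Proof.
  revert f c; induction n as [|n IH]; intros f c H x; simpl in *.
  - rewrite H; ring.
  - rewrite <- Delta_n_Delta_comm.
    rewrite (IH (Delta (INR N * h) f) (INR N * c)); [ring|].
    intro y; rewrite Delta_n_Delta_comm; now apply Delta_mult_const.
Qed.

(** A difference with step [- h] is minus the difference with step [h] taken from the base point
    [x - h]. *)
Lemma Delta_n_opp (n : nat) (h : R) (f : R -> R) (x : R) :
  Delta_n n (- h) f x = (-1) ^ n * Delta_n n h f (x - INR n * h).
Proof.
  revert x; induction n as [|n IH]; intro x.
  - simpl; rewrite Rmult_0_l, Rminus_0_r; ring.
  - rewrite S_INR; simpl; unfold Delta; rewrite !IH.
    replace (x - (INR n + 1) * h + h) with (x - INR n * h) by ring.
    replace (x + - h - INR n * h) with (x - (INR n + 1) * h) by ring.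
    ring.
Qed.

(** * Newton interpolation and polynomial functions *)

(** The binomial coefficient polynomial [t (t - 1) ... (t - i + 1) / i!]. *)
Fixpoint newton_basis (i : nat) (t : R) : R :=
  match i with
  | O => 1
  | S j => (t - INR j) * (/ INR (S j) * newton_basis j t)
  end.

(** Pascal's rule for binomial polynomials. *)
Lemma newton_basis_diff (i : nat) (t : R) :
  newton_basis (S i) (t + 1) = newton_basis (S i) t + newton_basis i t.
Proof.
  induction i as [|i IH].
  - simpl; field.
  - remember (S i) as j.
    assert (Hj : INR j <> 0) by (subst; apply not_0_INR; lia).
    assert (Hj1 : INR j + 1 <> 0) by (rewrite <- S_INR; apply not_0_INR; lia).
    change ((t + 1 - INR j) * (/ INR (S j) * newton_basis j (t + 1)) =
      (t - INR j) * (/ INR (S j) * newton_basis j t) + newton_basis j t).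
    rewrite IH, S_INR.
    assert (E : INR j * newton_basis j t = (t - INR i) * newton_basis i t).
    { subst j.
      change (newton_basis (S i) t) with ((t - INR i) * (/ INR (S i) * newton_basis i t)).
      field; exact Hj. }
    assert (Hi : INR j = INR i + 1) by (subst; apply S_INR).
    apply Rmult_eq_reg_l with (INR j + 1); [|exact Hj1].
    field_simplify; [|exact Hj1|exact Hj1].
    rewrite Hi in *; lra.
Qed.

Lemma newton_basis_0 (i : nat) : newton_basis (S i) 0 = 0.
Proof.
  induction i as [|i IH]; [simpl; ring|].
  change ((0 - INR (S i)) * (/ INR (S (S i)) * newton_basis (S i) 0) = 0).
  rewrite IH; ring.
Qed.

Fixpoint newton_sum (d : nat) (c : nat -> R) (t : R) : R :=
  match d with
  | O => c O
  | S e => newton_sum e c t + c (S e) * newton_basis (S e) t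
  end.

Lemma newton_sum_diff (d : nat) (c : nat -> R) (t : R) :
  newton_sum (S d) c (t + 1) = newton_sum (S d) c t + newton_sum d (fun i => c (S i)) t.
Proof.
  induction d as [|d IH].
  - simpl; field.
  - change (newton_sum (S (S d)) c (t + 1)) with
      (newton_sum (S d) c (t + 1) + c (S (S d)) * newton_basis (S (S d)) (t + 1)).
    change (newton_sum (S (S d)) c t) with
      (newton_sum (S d) c t + c (S (S d)) * newton_basis (S (S d)) t).
    change (newton_sum (S d) (fun i => c (S i)) t) with
      (newton_sum d (fun i => c (S i)) t + c (S (S d)) * newton_basis (S d) t).
    rewrite IH, newton_basis_diff; ring.
Qed.

Lemma newton_sum_0 (d : nat) (c : nat -> R) : newton_sum d c 0 = c O.
Proof.
  induction d as [|d IH]; [reflexivity|].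
  change (newton_sum d c 0 + c (S d) * newton_basis (S d) 0 = c O).
  rewrite IH, newton_basis_0; ring.
Qed.

(** Discrete integration: an expansion of [Delta h f] becomes one of [f] when its coefficients are
    shifted by one place and [f x] is put in front. *)
Lemma newton_interpolation (d : nat) (h x : R) (f : R -> R) :
  (forall y, Delta_n (S d) h f y = 0) ->
  exists c, forall m : nat, f (x + INR m * h) = newton_sum d c (INR m).
Proof.
  revert f; induction d as [|d IH]; intros f H.
  - exists (fun _ => f x); intro m; simpl newton_sum.
    induction m as [|m IHm].
    + simpl; f_equal; ring.
    + specialize (H (x + INR m * h)); simpl in H; unfold Delta in H.
      rewrite S_INR.
      replace (x + (INR m + 1) * h) with (x + INR m * h + h) by ring; lra.
  - destruct (IH (Delta h f)) as [c Hc].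
    { intro y; rewrite Delta_n_Delta_comm; apply H. }
    exists (fun i => match i with O => f x | S j => c j end); intro m.
    induction m as [|m IHm].
    + simpl (INR 0); rewrite newton_sum_0; f_equal; ring.
    + rewrite S_INR, newton_sum_diff, <- IHm.
      change (fun i : nat => c i) with c.
      rewrite <- Hc; unfold Delta.
      replace (x + (INR m + 1) * h) with (x + INR m * h + h) by ring; ring.
Qed.

(* Polynomial functions of degree at most [n], through divisibility of
   [p t - p a] by [t - a] for every [a]. *)
Fixpoint poly_fun (n : nat) (p : R -> R) : Prop :=
  match n with
  | O => exists c, forall t, p t = c
  | S m => forall a, exists q, poly_fun m q /\ forall t, p t = p a + (t - a) * q t
  end.

Lemma poly_fun_S (n : nat) (p : R -> R) : poly_fun n p -> poly_fun (S n) p.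
Proof.
  revert p; induction n as [|n IH]; intros p H.
  - destruct H as [c Hc]; intro a; exists (fun _ => 0); split; [now exists 0|].
    intro t; rewrite !Hc; ring.
  - intro a; destruct (H a) as [q [Hq E]]; exists q; split; auto.
Qed.

Lemma poly_fun_const (n : nat) (c : R) : poly_fun n (fun _ => c).
Proof. induction n as [|n IH]; [now exists c | now apply poly_fun_S]. Qed.

Lemma poly_fun_lincomb (n : nat) (p q : R -> R) (k : R) :
  poly_fun n p -> poly_fun n q -> poly_fun n (fun t => p t + k * q t).
Proof.
  revert p q; induction n as [|n IH]; intros p q Hp Hq.
  - destruct Hp as [c Hc], Hq as [e He]; exists (c + k * e); intro t; now rewrite Hc, He.
  - intro a; destruct (Hp a) as [p' [Hp' Ep]], (Hq a) as [q' [Hq' Eq]].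
    exists (fun t => p' t + k * q' t); split; [now apply IH|].
    intro t; rewrite Ep, Eq; ring.
Qed.

Lemma poly_fun_mult_linear (n : nat) (q : R -> R) (b : R) :
  poly_fun n q -> poly_fun (S n) (fun t => (t - b) * q t).
Proof.
  intros Hq s.
  destruct n as [|n].
  - destruct Hq as [c Hc]; exists q; split; [now exists c|].
    intro t; rewrite !Hc; ring.
  - destruct (Hq s) as [q' [Hq' E]].
    exists (fun t => q t + (s - b) * q' t); split.
    + apply poly_fun_lincomb; [exact Hq | now apply poly_fun_S].
    + intro t; rewrite (E t); ring.
Qed.

Lemma poly_fun_ext (n : nat) (p q : R -> R) :
  (forall t, p t = q t) -> poly_fun n p -> poly_fun n q.
Proof.
  intros H; destruct n as [|n]; simpl.
  - intros [c Hc]; exists c; intro t; now rewrite <- H.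
  - intros Hp a; destruct (Hp a) as [r [Hr E]]; exists r; split; auto.
    intro t; now rewrite <- !H.
Qed.

Lemma newton_basis_poly (i : nat) : poly_fun i (newton_basis i).
Proof.
  induction i as [|i IH]; [exists 1; auto|].
  change (newton_basis (S i)) with
    (fun t => (t - INR i) * (/ INR (S i) * newton_basis i t)).
  apply poly_fun_mult_linear.
  apply poly_fun_ext with (fun t => 0 + / INR (S i) * newton_basis i t).
  - intro; ring.
  - apply poly_fun_lincomb; [apply poly_fun_const | exact IH].
Qed.

Lemma newton_sum_poly (d : nat) (c : nat -> R) : poly_fun d (newton_sum d c).
Proof.
  induction d as [|d IH]; [exists (c O); auto|].
  apply (poly_fun_lincomb (S d) (newton_sum d c)); [now apply poly_fun_S | apply newton_basis_poly].
Qed.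

Lemma poly_fun_continuity (n : nat) (p : R -> R) : poly_fun n p -> continuity p.
Proof.
  revert p; induction n as [|n IH]; intros p H x.
  - destruct H as [c Hc].
    intros e He; exists 1; split; [lra|]; intros y _.
    rewrite !Hc; simpl; unfold Rdist; rewrite Rminus_diag, Rabs_R0; exact He.
  - destruct (H 0) as [q [Hq E]].
    assert (C : continuity_pt (fun t => p 0 + (t - 0) * q t) x).
    { apply (continuity_plus (fun _ => p 0) (fun t => (t - 0) * q t)).
      - apply continuity_const; intros ? ?; reflexivity.
      - apply (continuity_mult (fun t => t - 0) q); [|now apply IH].
        apply derivable_continuous.
        apply (derivable_minus (fun t => t) (fun _ => 0));
          [apply derivable_id | apply derivable_const]. }
    intros e He; destruct (C e He) as [d [Hd Hd']]; exists d; split; auto.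
    intros y Hy; rewrite (E y), (E x); now apply Hd'.
Qed.

(** The root [INR M] is divided out and the quotient vanishes at all later naturals, so [M] moves up
    while the degree bound goes down. *)
Lemma poly_fun_zero_of_nat_roots (n M : nat) (p : R -> R) :
  poly_fun n p -> (forall m, (M <= m)%nat -> p (INR m) = 0) -> forall t, p t = 0.
Proof.
  revert M p; induction n as [|n IH]; intros M p Hp H t.
  - destruct Hp as [c Hc]; rewrite Hc, <- (Hc (INR M)); apply H; lia.
  - destruct (Hp (INR M)) as [q [Hq E]].
    rewrite E, (H M) by lia.
    rewrite (IH (S M) q Hq); [ring|].
    intros m Hm.
    assert (L : INR M < INR m) by (apply lt_INR; lia).
    assert (Hm0 := H m); rewrite E, (H M) in Hm0 by lia.
    assert (Z : (INR m - INR M) * q (INR m) = 0) by (rewrite <- Hm0 by lia; ring).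
    apply Rmult_integral in Z; destruct Z; [lra | assumption].
Qed.

Lemma poly_fun_scale (n : nat) (p : R -> R) (k : R) :
  poly_fun n p -> poly_fun n (fun t => p (k * t)).
Proof.
  revert p; induction n as [|n IH]; intros p H.
  - destruct H as [c Hc]; exists c; auto.
  - intro a; destruct (H (k * a)) as [q [Hq E]].
    exists (fun t => 0 + k * q (k * t)); split.
    + apply (poly_fun_lincomb n (fun _ => 0) (fun t => q (k * t)));
        [apply poly_fun_const | now apply IH].
    + intro t; rewrite E; ring.
Qed.

Lemma continuity_eps (p : R -> R) (x e : R) : continuity_pt p x -> 0 < e ->
  exists d, 0 < d /\ forall y, Rabs (y - x) < d -> Rabs (p y - p x) < e.
Proof.
  intros C He; destruct (C e He) as [d [Hd H]]; exists d; split; auto.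
  intros y Hy; destruct (Req_dec x y) as [->|N].
  - rewrite Rminus_diag, Rabs_R0; exact He.
  - apply H; repeat split; auto.
Qed.

Lemma pow_continuity (n : nat) : continuity (fun x => x ^ n).
Proof. apply derivable_continuous; intro x; apply derivable_pt_pow. Qed.

(** For a positive exponent the bound forces [p t0 = 0] by continuity; dividing [p] and the bound by
    [t - t0] lowers the exponent by one. *)
Lemma poly_fun_order (n : nat) (p : R -> R) (t0 C e : R) :
  poly_fun n p -> 0 < e ->
  (forall t, 0 < Rabs (t - t0) < e -> Rabs (p t) <= C * Rabs (t - t0) ^ n) ->
  exists k, forall t, p t = k * (t - t0) ^ n.
Proof.
  intros Hp He; revert p Hp; induction n as [|n IH]; intros p Hp H.
  - destruct Hp as [c Hc]; exists c; intro t; rewrite Hc; simpl; ring.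
  - assert (Z : p t0 = 0).
    { destruct (Req_dec (p t0) 0) as [|N]; auto; exfalso.
      assert (P : 0 < Rabs (p t0)) by now apply Rabs_pos_lt.
      destruct (continuity_eps p t0 (Rabs (p t0) / 2)) as [d [Hd Hd']];
        [now apply (poly_fun_continuity (S n)) | lra |].
      assert (HC : 0 < Rabs C + 1) by (pose proof (Rabs_pos C); lra).
      (* At [t0 + s] continuity keeps [p] within half of its value at [t0], while [s <= 1 / 2] and
         the last bound make [C * s ^ S n] at most a quarter of [Rabs (p t0)]. *)
      set (s := Rmin (Rmin (d / 2) (e / 2)) (Rmin (1 / 2) (Rabs (p t0) / (4 * (Rabs C + 1))))).
      assert (Q : 0 < Rabs (p t0) / (4 * (Rabs C + 1))) by (apply Rdiv_lt_0_compat; lra).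
      assert (s > 0) by (unfold s; repeat apply Rmin_pos; lra).
      assert (s <= d / 2 /\ s <= e / 2 /\ s <= 1 / 2 /\
        s <= Rabs (p t0) / (4 * (Rabs C + 1))) as [S1 [S2 [S3 S4]]].
      { unfold s.
        pose proof (Rmin_l (Rmin (d / 2) (e / 2)) (Rmin (1 / 2) (Rabs (p t0) / (4 * (Rabs C + 1))))).
        pose proof (Rmin_r (Rmin (d / 2) (e / 2)) (Rmin (1 / 2) (Rabs (p t0) / (4 * (Rabs C + 1))))).
        pose proof (Rmin_l (d / 2) (e / 2)); pose proof (Rmin_r (d / 2) (e / 2)).
        pose proof (Rmin_l (1 / 2) (Rabs (p t0) / (4 * (Rabs C + 1)))).
        pose proof (Rmin_r (1 / 2) (Rabs (p t0) / (4 * (Rabs C + 1)))).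
        repeat split; lra. }
      assert (A : Rabs (t0 + s - t0) = s)
        by (replace (t0 + s - t0) with s by ring; apply Rabs_right; lra).
      specialize (H (t0 + s)); specialize (Hd' (t0 + s)); rewrite A in H, Hd'.
      assert (B1 := H ltac:(lra)); assert (B2 := Hd' ltac:(lra)).
      assert (B3 : s ^ S n <= s).
      { simpl; rewrite <- (Rmult_1_r s) at 3; apply Rmult_le_compat_l; [lra|].
        rewrite <- (pow1 n); apply pow_incr; lra. }
      assert (B4 : 0 <= s ^ S n) by (apply pow_le; lra).
      assert (B5 : C * s ^ S n <= (Rabs C + 1) * s).
      { pose proof (Rle_abs C); nra. }
      assert (B6 : (Rabs C + 1) * s <= Rabs (p t0) / 4).
      { replace (Rabs (p t0) / 4) with ((Rabs C + 1) * (Rabs (p t0) / (4 * (Rabs C + 1))))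
          by (field; lra).
        apply Rmult_le_compat_l; lra. }
      pose proof (Rabs_triang_inv (p t0) (p (t0 + s))).
      rewrite (Rabs_minus_sym (p t0)) in H1; lra. }
    destruct (Hp t0) as [q [Hq E]].
    destruct (IH q Hq) as [k Hk].
    + intros t Ht; specialize (H t Ht).
      rewrite E, Z, Rplus_0_l, Rabs_mult in H; simpl in H.
      apply Rmult_le_reg_l with (Rabs (t - t0)); lra.
    + exists k; intro t; rewrite E, Z, Hk; simpl; ring.
Qed.

Lemma fraction_dense (u v : R) : 0 <= u -> u < v ->
  exists a b : nat, (0 < a)%nat /\ (0 < b)%nat /\ u < INR a / INR b < v.
Proof.
  intros Hu Huv.
  destruct (INR_archimed (v - u) 1) as [b Hb]; [lra|].
  assert (Pb : 0 < INR b).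
  { destruct (Req_dec (INR b) 0) as [Z|Z]; [rewrite Z in Hb | pose proof (pos_INR b)]; lra. }
  destruct (archimed (u * INR b)) as [A1 A2].
  assert (Hz : (0 < up (u * INR b))%Z) by (apply lt_IZR; nra).
  exists (Z.to_nat (up (u * INR b))), b.
  rewrite (INR_IZR_INZ (Z.to_nat _)), Z2Nat.id by lia.
  split; [lia|]; split; [now apply INR_lt|].
  split; apply Rmult_lt_reg_r with (INR b); auto;
    unfold Rdiv; rewrite Rmult_assoc, Rinv_l, Rmult_1_r; nra.
Qed.

(** * Monomial functions on rational lines *)

Lemma monomial_Delta_n (n : nat) (f : R -> R) : n_monomial n f ->
  forall x h, Delta_n n h f x = INR (fact n) * f h.
Proof.
  intros H x h; rewrite <- (H x h); field; apply INR_fact_neq_0.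
Qed.

(** Up to the factor [n!], [f h] is the [n]-th difference with step [h], so it scales as that
    difference does. *)
Lemma monomial_nat (n N : nat) (f : R -> R) (x : R) : n_monomial n f ->
  f (INR N * x) = INR N ^ n * f x.
Proof.
  intro H; rewrite <- (H 0 (INR N * x)).
  rewrite (Delta_n_mult_const N n x (INR (fact n) * f x));
    [field; apply INR_fact_neq_0 | intro; now apply monomial_Delta_n].
Qed.

Lemma monomial_0 (n : nat) (f : R -> R) : n_monomial n f -> (1 <= n)%nat -> f 0 = 0.
Proof.
  intros H Hn; pose proof (monomial_nat n 0 f 0 H) as E; simpl (INR 0) in E.
  rewrite Rmult_0_l, pow_i in E by lia; lra.
Qed.

Lemma monomial_fraction (n a b : nat) (f : R -> R) (x : R) : n_monomial n f ->
  (0 < b)%nat -> f (INR a / INR b * x) = (INR a / INR b) ^ n * f x.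
Proof.
  intros H Hb.
  assert (Nb : INR b <> 0) by (apply not_0_INR; lia).
  assert (E : f (INR a * x) = f (INR b * (INR a / INR b * x))) by (f_equal; field; exact Nb).
  rewrite !(monomial_nat n _ f) in E by assumption.
  unfold Rdiv at 2; rewrite Rpow_mult_distr, pow_inv.
  apply Rmult_eq_reg_l with (INR b ^ n); [|now apply pow_nonzero].
  rewrite <- E; field; now apply pow_nonzero.
Qed.

Lemma monomial_opp (n : nat) (f : R -> R) (x : R) : n_monomial n f ->
  f (- x) = (-1) ^ n * f x.
Proof.
  intro H; rewrite <- (H 0 (- x)), Delta_n_opp, (monomial_Delta_n n f H).
  field; apply INR_fact_neq_0.
Qed.

(** The [n]-th differences do not depend on the base point, so those of order [n + 1] vanish and
    interpolation applies on every grid of step [k / b]. The polynomial of that grid, rescaled by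
    [b], agrees with the one of step [k] at all naturals, so one polynomial serves every [b]. *)
Lemma monomial_poly_on_line (n : nat) (f : R -> R) (x k : R) : n_monomial n f ->
  exists p, poly_fun n p /\ forall a b : nat, (0 < b)%nat ->
    f (x + INR a / INR b * k) = p (INR a / INR b).
Proof.
  intro H.
  assert (Z : forall h y, Delta_n (S n) h f y = 0).
  { intros h y; simpl; unfold Delta; rewrite !(monomial_Delta_n n f H); ring. }
  destruct (newton_interpolation n k x f (Z k)) as [c Hc].
  exists (newton_sum n c); split; [apply newton_sum_poly|].
  intros a b Hb.
  assert (Nb : INR b <> 0) by (apply not_0_INR; lia).
  destruct (newton_interpolation n (k / INR b) x f (Z _)) as [c' Hc'].
  replace (INR a / INR b * k) with (INR a * (k / INR b)) by (field; exact Nb).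
  rewrite Hc'.
  assert (E : forall t, newton_sum n c' (INR b * t) + (-1) * newton_sum n c t = 0).
  { apply (poly_fun_zero_of_nat_roots n 0).
    - apply (poly_fun_lincomb n (fun t => newton_sum n c' (INR b * t)));
        [apply poly_fun_scale|]; apply newton_sum_poly.
    - intros m _; rewrite <- Hc, <- mult_INR, <- Hc', mult_INR.
      replace (INR b * INR m * (k / INR b)) with (INR m * k) by (field; exact Nb); ring. }
  specialize (E (INR a / INR b)).
  replace (INR b * (INR a / INR b)) with (INR a) in E by (field; exact Nb); lra.
Qed.

(** * Slopes: dilation invariance, unboundedness and density of values *)

Definition slope (n : nat) (f : R -> R) (x : R) : R := f x / x ^ n.

Lemma slope_spec (n : nat) (f : R -> R) (x : R) : x <> 0 -> f x = slope n f x * x ^ n.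
Proof. intro H; unfold slope; field; now apply pow_nonzero. Qed.

Lemma slope_fraction (n a b : nat) (f : R -> R) (x : R) : n_monomial n f ->
  (0 < a)%nat -> (0 < b)%nat -> x <> 0 -> slope n f (INR a / INR b * x) = slope n f x.
Proof.
  intros H Ha Hb Hx; unfold slope.
  rewrite (monomial_fraction n a b f x H Hb), Rpow_mult_distr.
  assert (INR a <> 0) by (apply not_0_INR; lia).
  assert (INR b <> 0) by (apply not_0_INR; lia).
  assert ((INR a / INR b) ^ n <> 0).
  { apply pow_nonzero; unfold Rdiv; apply Rmult_integral_contrapositive_currified;
      [assumption | now apply Rinv_neq_0_compat]. }
  field; split; auto; now apply pow_nonzero.
Qed.

Lemma slope_opp (n : nat) (f : R -> R) (x : R) : n_monomial n f -> x <> 0 ->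
  slope n f (- x) = slope n f x.
Proof.
  intros H Hx; unfold slope; rewrite (monomial_opp n f x H).
  replace (- x) with (-1 * x) by ring; rewrite Rpow_mult_distr.
  field; split; apply pow_nonzero; auto; lra.
Qed.

(** Positive rational multiples of [x] share its slope and are dense in the positive half-line;
    reflection carries this to the negative one. *)
Lemma slope_dense_domain (n : nat) (f : R -> R) (x u v : R) : n_monomial n f ->
  0 < x -> u < v -> 0 <= u \/ v <= 0 ->
  exists y, u < y < v /\ y <> 0 /\ slope n f y = slope n f x.
Proof.
  intros H Hx Huv.
  assert (P : forall u v, 0 <= u -> u < v ->
    exists y, u < y < v /\ y <> 0 /\ slope n f y = slope n f x).
  { clear u v Huv; intros u v Hu Huv.
    destruct (fraction_dense (u / x) (v / x)) as [a [b [Ha [Hb [H1 H2]]]]].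
    - apply Rmult_le_pos; [lra | left; now apply Rinv_0_lt_compat].
    - apply Rmult_lt_compat_r; [now apply Rinv_0_lt_compat | lra].
    - assert (u < INR a / INR b * x < v).
      { split; apply Rmult_lt_reg_r with (/ x); try now apply Rinv_0_lt_compat.
        - rewrite Rmult_assoc, Rinv_r; lra.
        - rewrite Rmult_assoc, Rinv_r; lra. }
      exists (INR a / INR b * x); split; [assumption|]; split; [lra|].
      apply slope_fraction; auto; lra. }
  intros [Hu|Hv]; [now apply P|].
  destruct (P (- v) (- u)) as [y [Hy [Hy0 E]]]; [lra|lra|].
  exists (- y); repeat split; try lra.
  now rewrite slope_opp.
Qed.

(* If the slopes are bounded, then along the line [x1 - t x2] the polynomial of degree at most
   [n] given by [f] vanishes to order [n] where the line meets [0]. *)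
Lemma slope_unbounded (n : nat) (f : R -> R) : n_monomial n f -> (1 <= n)%nat ->
  ~ continuity f -> forall C, exists x, 0 < x /\ C < Rabs (slope n f x).
Proof.
  intros H Hn NC C; apply NNPP; intro NE; apply NC.
  assert (B : forall x, 0 < x -> Rabs (slope n f x) <= C).
  { intros x Hx; apply Rnot_lt_le; intro L; apply NE; now exists x. }
  assert (f0 : f 0 = 0) by now apply (monomial_0 n).
  assert (Bf : forall x, Rabs (f x) <= C * Rabs x ^ n).
  { intro x; destruct (Req_dec x 0) as [->|Nx].
    - rewrite f0, Rabs_R0, pow_i by lia; lra.
    - rewrite (slope_spec n f x Nx), Rabs_mult, <- RPow_abs.
      apply Rmult_le_compat_r; [apply pow_le, Rabs_pos|].
      destruct (Rlt_le_dec 0 x); [now apply B|].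
      rewrite <- slope_opp by assumption; apply B; lra. }
  (* The parameter [t0 = x1 / x2] is where the line reaches 0. Once [p t = k * (t - t0) ^ n], the
     parameters 0 and 1 give equal slopes. *)
  assert (E1 : forall x1 x2, 0 < x2 < x1 -> slope n f x1 = slope n f (x1 - x2)).
  { intros x1 x2 [P2 P1].
    destruct (monomial_poly_on_line n f x1 (- x2) H) as [p [Hp Ep]].
    set (t0 := x1 / x2).
    assert (Pt : 1 < t0).
    { apply Rmult_lt_reg_r with x2; auto; unfold t0, Rdiv; rewrite Rmult_assoc, Rinv_l; lra. }
    assert (Et : forall t, x1 + t * - x2 = - x2 * (t - t0)) by (intro; unfold t0; field; lra).
    destruct (poly_fun_order n p t0 (C * Rabs x2 ^ n) 1 Hp) as [k Hk]; [lra| |].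
    - intros t Ht.
      (* The bound on [f] gives the bound on [p] at rational parameters only. A failure at [t] would
         persist, by continuity, at a nearby fraction; [t] is positive because [t0 > 1]. *)
      apply Rnot_lt_le; intro L.
      set (h := fun t => Rabs (p t) - C * Rabs x2 ^ n * Rabs (t - t0) ^ n).
      assert (Ch : continuity h).
      { apply continuity_minus.
        - apply (continuity_comp p Rabs); [now apply (poly_fun_continuity n) | apply Rcontinuity_abs].
        - apply continuity_mult; [apply continuity_const; intros ? ?; reflexivity|].
          apply (continuity_comp (fun t => Rabs (t - t0)) (fun x => x ^ n)); [|apply pow_continuity].
          apply (continuity_comp (fun t => t - t0) Rabs); [|apply Rcontinuity_abs].
          apply continuity_minus; [apply derivable_continuous, derivable_id|].
          apply continuity_const; intros ? ?; reflexivity. }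
      destruct (continuity_eps h t (h t) (Ch t)) as [d [Hd Hd']]; [unfold h; lra|].
      assert (Pt' : 0 < t).
      { destruct Ht as [_ Ht]; apply Rabs_def2 in Ht; lra. }
      destruct (fraction_dense t (t + d)) as [a [b [Ha [Hb Hab]]]]; [lra|lra|].
      assert (L2 := Hd' (INR a / INR b) ltac:(apply Rabs_def1; lra)).
      assert (L3 : h (INR a / INR b) <= 0).
      { unfold h; rewrite <- Ep by assumption; rewrite Et.
        pose proof (Bf (- x2 * (INR a / INR b - t0))) as L3.
        rewrite Rabs_mult, Rpow_mult_distr, Rabs_Ropp in L3; lra. }
      apply Rabs_def2 in L2; lra.
    - pose proof (Ep 0%nat 1%nat ltac:(lia)) as F0; pose proof (Ep 1%nat 1%nat ltac:(lia)) as F1.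
      simpl INR in F0, F1.
      replace (x1 + 0 / 1 * - x2) with x1 in F0 by field.
      replace (x1 + 1 / 1 * - x2) with (x1 - x2) in F1 by field.
      unfold slope; rewrite F0, F1, !Hk.
      replace (x1 - x2) with (- x2 * (1 / 1 - t0)) by (unfold t0; field; lra).
      replace (x1 ^ n) with ((- x2 * (0 / 1 - t0)) ^ n) by (f_equal; unfold t0; field; lra).
      rewrite !Rpow_mult_distr; field.
      repeat split; apply pow_nonzero; lra. }
  assert (E2 : forall x, f x = slope n f 1 * x ^ n).
  { assert (E3 : forall x, 0 < x -> slope n f x = slope n f 1).
    { intros x Hx.
      transitivity (slope n f (x + 1)).
      - rewrite (E1 (x + 1) 1) by lra; f_equal; ring.
      - rewrite (E1 (x + 1) x) by lra; f_equal; ring. }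
    intro x; destruct (Req_dec x 0) as [->|Nx].
    - rewrite f0, pow_i by lia; ring.
    - rewrite (slope_spec n f x Nx); f_equal.
      destruct (Rlt_le_dec 0 x); [now apply E3|].
      rewrite <- slope_opp by assumption; apply E3; lra. }
  intro x; intros e He.
  destruct (continuity_mult (fun _ => slope n f 1) (fun x => x ^ n)) with (x := x) (eps := e)
    as [d [Hd Hd']]; auto.
  - apply continuity_const; intros ? ?; reflexivity.
  - apply pow_continuity.
  - exists d; split; auto; intros y Hy; rewrite !E2; now apply Hd'.
Qed.

(** Along the segment from [x1] to [x2], [f] agrees at rational parameters with a polynomial [p].
    The intermediate value theorem gives a root of [p - z * l ^ n], and a fraction close to this
    root gives a slope close to [z]. *)
Lemma slope_intermediate (n : nat) (f : R -> R) (x1 x2 z e : R) : n_monomial n f ->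
  0 < x1 -> 0 < x2 -> slope n f x1 < z < slope n f x2 -> 0 < e ->
  exists x, 0 < x /\ Rabs (slope n f x - z) < e.
Proof.
  intros H P1 P2 [Z1 Z2] He.
  destruct (monomial_poly_on_line n f x1 (x2 - x1) H) as [p [Hp Ep]].
  set (l := fun t => x1 + t * (x2 - x1)).
  assert (Cl : continuity l).
  { apply continuity_plus; [apply continuity_const; intros ? ?; reflexivity|].
    apply continuity_mult; [apply derivable_continuous, derivable_id|].
    apply continuity_const; intros ? ?; reflexivity. }
  assert (Pl : forall t, 0 <= t <= 1 -> 0 < l t).
  { intros t Ht; unfold l.
    replace (x1 + t * (x2 - x1)) with ((1 - t) * x1 + t * x2) by ring.
    destruct (Req_dec t 0) as [->|]; [lra|].
    assert (0 < t * x2) by (apply Rmult_lt_0_compat; lra).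
    assert (0 <= (1 - t) * x1) by (apply Rmult_le_pos; lra).
    lra. }
  set (h := fun t => p t - z * l t ^ n).
  assert (Ch : continuity h).
  { apply continuity_minus; [now apply (poly_fun_continuity n)|].
    apply continuity_mult; [apply continuity_const; intros ? ?; reflexivity|].
    now apply (continuity_comp l (fun x => x ^ n)); [|apply pow_continuity]. }
  assert (F : forall a b, (0 < b)%nat -> 0 <= INR a / INR b <= 1 ->
     h (INR a / INR b) = (slope n f (l (INR a / INR b)) - z) * l (INR a / INR b) ^ n).
  { intros a b Hb Hab; unfold h; rewrite <- Ep by assumption.
    change (x1 + INR a / INR b * (x2 - x1)) with (l (INR a / INR b)).
    rewrite (slope_spec n f (l (INR a / INR b))) at 1; [ring|].
    specialize (Pl _ Hab); lra. }
  assert (h0 : h 0 < 0).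
  { replace 0 with (INR 0 / INR 1) at 1 by (simpl; field).
    rewrite F by (try lia; simpl; lra).
    replace (l (INR 0 / INR 1)) with x1 by (unfold l; simpl; field).
    assert (0 < x1 ^ n) by now apply pow_lt.
    nra. }
  assert (h1 : 0 < h 1).
  { replace 1 with (INR 1 / INR 1) at 1 by (simpl; field).
    rewrite F by (try lia; simpl; lra).
    replace (l (INR 1 / INR 1)) with x2 by (unfold l; simpl; field).
    assert (0 < x2 ^ n) by now apply pow_lt.
    apply Rmult_lt_0_compat; lra. }
  destruct (IVT h 0 1 Ch) as [t [Ht ht]]; [lra|assumption|assumption|].
  assert (t <> 1) by (intros ->; lra).
  pose proof (Pl t Ht) as Plt.
  assert (Q : 0 < l t ^ n) by now apply pow_lt.
  assert (C1 : continuity (fun t => l t ^ n)) by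
    now apply (continuity_comp l (fun x => x ^ n)); [|apply pow_continuity].
  (* The radius [d1] keeps [l s ^ n] above half of [l t ^ n], so the bound from [d2] can be divided
     by [l s ^ n] and leaves an error below [e]. *)
  destruct (continuity_eps _ t (l t ^ n / 2) (C1 t)) as [d1 [Hd1 D1]]; [lra|].
  destruct (continuity_eps h t (e * (l t ^ n / 2)) (Ch t)) as [d2 [Hd2 D2]];
    [apply Rmult_lt_0_compat; lra|].
  destruct (fraction_dense t (Rmin 1 (t + Rmin d1 d2))) as [a [b [Ha [Hb [L1 L2]]]]]; [lra| |].
  { apply Rmin_glb_lt; [lra|]; assert (0 < Rmin d1 d2) by now apply Rmin_pos. lra. }
  pose proof (Rmin_l 1 (t + Rmin d1 d2)); pose proof (Rmin_r 1 (t + Rmin d1 d2)).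
  pose proof (Rmin_l d1 d2); pose proof (Rmin_r d1 d2).
  set (s := INR a / INR b) in *.
  assert (As : Rabs (s - t) = s - t) by (apply Rabs_right; lra).
  specialize (D1 s ltac:(lra)); specialize (D2 s ltac:(lra)).
  assert (Fs := F a b Hb ltac:(fold s; lra)); fold s in Fs.
  exists (l s); split; [apply Pl; lra|].
  simpl in D1; apply Rabs_def2 in D1.
  rewrite ht, Rminus_0_r, Fs, Rabs_mult, (Rabs_right (l s ^ n)) in D2 by lra.
  apply Rnot_le_lt; intro L.
  assert (e * (l t ^ n / 2) <= Rabs (slope n f (l s) - z) * l s ^ n); [|lra].
  apply Rmult_le_compat; lra.
Qed.

(** * Topology of the plane with square neighbourhoods *)

Definition near (e : R) (p q : R2) : Prop :=
  Rabs (fst p - fst q) < e /\ Rabs (snd p - snd q) < e.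

Lemma near_refl (e : R) (p : R2) : 0 < e -> near e p p.
Proof. intro; split; rewrite Rminus_diag, Rabs_R0; assumption. Qed.

Lemma near_sym (e : R) (p q : R2) : near e p q -> near e q p.
Proof. intros [H1 H2]; split; rewrite Rabs_minus_sym; assumption. Qed.

Lemma near_trans (e e' : R) (p q r : R2) : near e p q -> near e' q r -> near (e + e') p r.
Proof.
  intros [H1 H2] [H3 H4]; apply Rabs_def2 in H1, H2, H3, H4.
  split; apply Rabs_def1; lra.
Qed.

Lemma near_weak (e e' : R) (p q : R2) : near e p q -> e <= e' -> near e' p q.
Proof. intros [H1 H2] L; split; lra. Qed.

Lemma near_dist2 (e : R) (p q : R2) : near (e / 2) p q -> dist2 p q < e.
Proof.
  intros [H1 H2]; unfold dist2.
  assert (He : 0 < e) by (pose proof (Rabs_pos (fst p - fst q)); lra).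
  rewrite <- (sqrt_pow2 e) by lra.
  pose proof (pow2_ge_0 (fst p - fst q)); pose proof (pow2_ge_0 (snd p - snd q)).
  apply sqrt_lt_1_alt; split; [lra|].
  apply Rabs_def2 in H1, H2; nra.
Qed.

Lemma dist2_near (e : R) (p q : R2) : dist2 p q < e -> near e p q.
Proof.
  intro H; unfold dist2 in H.
  assert (P1 := pow2_ge_0 (fst p - fst q)); assert (P2 := pow2_ge_0 (snd p - snd q)).
  split; eapply Rle_lt_trans; try exact H;
    rewrite <- sqrt_Rsqr_abs; apply sqrt_le_1_alt; unfold Rsqr; lra.
Qed.

Lemma open2_near (U : set2) :
  open2 U <-> forall p, U p -> exists e, 0 < e /\ forall q, near e p q -> U q.
Proof.
  split; intros H p Hp; destruct (H p Hp) as [e [He E]].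
  - exists (e / 2); split; [lra|]; intros q Hq; apply E; now apply near_dist2.
  - exists e; split; [lra|]; intros q Hq; apply E; now apply dist2_near.
Qed.

Lemma closure2_near (A : set2) (p : R2) :
  closure2 A p <-> forall e, 0 < e -> exists q, A q /\ near e p q.
Proof.
  split; intros H e He.
  - destruct (H e He) as [q [Hq D]]; exists q; split; [assumption | now apply dist2_near].
  - destruct (H (e / 2)) as [q [Hq D]]; [lra|]; exists q; split;
      [assumption | now apply near_dist2].
Qed.

Lemma interior2_near (A : set2) (p : R2) :
  interior2 A p <-> exists e, 0 < e /\ forall q, near e p q -> A q.
Proof.
  split; intros [e [He E]].
  - exists (e / 2); split; [lra|]; intros q Hq; apply E; now apply near_dist2.
  - exists e; split; [lra|]; intros q Hq; apply E; now apply dist2_near.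
Qed.

Lemma near_open2 (e : R) (p : R2) : open2 (near e p).
Proof.
  apply open2_near; intros q [H1 H2].
  exists (Rmin (e - Rabs (fst p - fst q)) (e - Rabs (snd p - snd q))).
  split; [apply Rmin_pos; lra|].
  intros r [L1 L2].
  pose proof (Rmin_l (e - Rabs (fst p - fst q)) (e - Rabs (snd p - snd q))).
  pose proof (Rmin_r (e - Rabs (fst p - fst q)) (e - Rabs (snd p - snd q))).
  pose proof (Rabs_triang (fst p - fst q) (fst q - fst r)).
  pose proof (Rabs_triang (snd p - snd q) (snd q - snd r)).
  replace (fst p - fst q + (fst q - fst r)) with (fst p - fst r) in * by ring.
  replace (snd p - snd q + (snd q - snd r)) with (snd p - snd r) in * by ring.
  split; lra.
Qed.

Definition closed2 (A : set2) : Prop :=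
  forall p, (forall e, 0 < e -> exists q, A q /\ near e p q) -> A p.

Lemma closed2_far (A : set2) (p : R2) : closed2 A -> ~ A p ->
  exists e, 0 < e /\ forall q, near e p q -> ~ A q.
Proof.
  intros HA Hp; apply NNPP; intro N; apply Hp, HA; intros e He.
  apply NNPP; intro N'; apply N; exists e; split; auto.
  intros q Hq Aq; apply N'; now exists q.
Qed.

Lemma closure2_closed (A : set2) : closed2 (closure2 A).
Proof.
  intros p H; apply closure2_near; intros e He.
  destruct (H (e / 2)) as [q [Hq D]]; [lra|].
  rewrite closure2_near in Hq; destruct (Hq (e / 2)) as [r [Hr D']]; [lra|].
  exists r; split; auto.
  replace e with (e / 2 + e / 2) by field; eapply near_trans; eauto.
Qed.

Lemma closed2_inter (A B : set2) : closed2 A -> closed2 B -> closed2 (fun p => A p /\ B p).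
Proof.
  intros HA HB p H; split; [apply HA | apply HB]; intros e He;
    destruct (H e He) as [q [[? ?] ?]]; now exists q.
Qed.

(** * Rectangles, compactness and connectedness *)

Definition rect (a b c d : R) : set2 := fun p => a <= fst p <= b /\ c <= snd p <= d.

Lemma le_of_near (u v : R) : (forall e, 0 < e -> u < v + e) -> u <= v.
Proof. intro H; apply Rnot_lt_le; intro L; specialize (H (u - v)); lra. Qed.

Lemma rect_closed2 (a b c d : R) : closed2 (rect a b c d).
Proof.
  intros p H; repeat split; apply le_of_near; intros e He;
    destruct (H e He) as [q [[? ?] [L1 L2]]]; apply Rabs_def2 in L1, L2; lra.
Qed.

(** The supremum of the right ends [x] with [good a x] is itself reached, and it cannot lie before
    [b]. This one induction along an interval serves both connectedness and compactness. *)
Lemma cousin (good : R -> R -> Prop) (a b : R) : a <= b ->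
  (forall u v w, u <= v <= w -> good u v -> good v w -> good u w) ->
  (forall x, a <= x <= b -> exists e, 0 < e /\
     forall u v, a <= u -> v <= b -> u <= x <= v -> x - e < u -> v < x + e -> good u v) ->
  good a b.
Proof.
  intros Hab Tr Loc.
  set (E := fun x => a <= x <= b /\ good a x).
  assert (Ea : E a).
  { split; [lra|]; destruct (Loc a) as [e [He L]]; [lra|]; apply L; lra. }
  destruct (completeness E) as [s [U1 U2]].
  - exists b; intros x [Hx _]; lra.
  - now exists a.
  - assert (Hs : a <= s <= b).
    { split; [now apply U1 | apply U2; intros x [Hx _]; lra]. }
    destruct (Loc s Hs) as [e [He L]].
    assert (exists x, E x /\ s - e < x) as [x [[Hx Gx] Lx]].
    { apply NNPP; intro N; assert (s <= s - e); [|lra].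
      apply U2; intros x Ex; apply Rnot_lt_le; intro; apply N; now exists x. }
    assert (x <= s) by now apply U1.
    set (s' := Rmin b (s + e / 2)).
    pose proof (Rmin_l b (s + e / 2)); pose proof (Rmin_r b (s + e / 2)).
    fold s' in H0, H1.
    assert (s <= s') by (apply Rmin_glb; lra).
    assert (G : good a s') by (apply (Tr a x s'); [lra|assumption|apply L; lra]).
    assert (s' <= s) by (apply U1; split; [lra|assumption]).
    assert (s' = b).
    { unfold s' in *; destruct (Rle_dec b (s + e / 2)); [now apply Rmin_left|].
      rewrite Rmin_right in * by lra; lra. }
    now rewrite <- H4.
Qed.

Lemma segment_connected (P : R -> Prop) (a b : R) : a <= b ->
  (forall x, a <= x <= b -> exists e, 0 < e /\
     forall y, a <= y <= b -> Rabs (x - y) < e -> (P x <-> P y)) ->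
  (P a <-> P b).
Proof.
  intros Hab H; apply (cousin (fun u v => P u <-> P v)); auto.
  - tauto.
  - intros x Hx; destruct (H x Hx) as [e [He L]]; exists e; split; auto.
    intros u v Hu Hv Huv L1 L2.
    rewrite <- (L u), <- (L v); [tauto|lra|apply Rabs_def1; lra|lra|apply Rabs_def1; lra].
Qed.

(** [cousin] is used twice: in the vertical direction to cover a thin strip around one line, merged
    pieces keeping the smaller width, and then in the horizontal direction to join such strips. *)
Lemma rect_compact (a b c d : R) : compact2 (rect a b c d).
Proof.
  intros I U HU Cov.
  set (fin := fun S : set2 => exists l : list I, forall p, S p -> exists i, In i l /\ U i p).
  assert (Fu : forall S1 S2 S : set2, fin S1 -> fin S2 -> (forall p, S p -> S1 p \/ S2 p) -> fin S).
  { intros S1 S2 S [l1 H1] [l2 H2] H; exists (l1 ++ l2); intros p Hp.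
    destruct (H p Hp) as [Q|Q]; [destruct (H1 p Q) as [i [Hi Ui]] | destruct (H2 p Q) as [i [Hi Ui]]];
      exists i; split; auto; apply in_or_app; auto. }
  destruct (Rle_dec a b) as [Hab|]; [|exists nil; intros p [? ?]; lra].
  destruct (Rle_dec c d) as [Hcd|]; [|exists nil; intros p [? ?]; lra].
  apply (cousin (fun u v => fin (rect u v c d)) a b Hab).
  - intros u v w Huvw F1 F2; apply (Fu _ _ _ F1 F2); intros p [P1 P2]; unfold rect.
    destruct (Rle_dec (fst p) v); [left | right]; lra.
  - intros x Hx.
    destruct (cousin (fun y z => exists e, 0 < e /\ fin (rect (x - e) (x + e) y z)) c d Hcd)
      as [e [He F]].
    + intros u v w Huvw [e1 [He1 F1]] [e2 [He2 F2]].
      exists (Rmin e1 e2); split; [now apply Rmin_pos|].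
      pose proof (Rmin_l e1 e2); pose proof (Rmin_r e1 e2).
      apply (Fu _ _ _ F1 F2); intros p [P1 P2]; unfold rect.
      destruct (Rle_dec (snd p) v); [left | right]; lra.
    + intros y Hy.
      destruct (Cov (x, y)) as [i Hi]; [split; simpl; lra|].
      destruct (proj1 (open2_near _) (HU i) _ Hi) as [e [He E]].
      exists e; split; auto; intros u v Hu Hv Huv L1 L2.
      exists (e / 2); split; [lra|]; exists (i :: nil).
      intros p [P1 P2]; exists i; split; [now left|].
      apply E; split; simpl; apply Rabs_def1; lra.
    + exists e; split; auto; intros u v Hu Hv Huv L1 L2.
      apply (Fu _ _ _ F F); intros p [P1 P2]; left; split; lra.
Qed.

(** The complement of [F] joins the cover under the index [None] and is removed from the finite
    subcover. *)
Lemma closed_compact (F : set2) (a b c d : R) :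
  closed2 F -> (forall p, F p -> rect a b c d p) -> compact2 F.
Proof.
  intros HF HR I U HU Cov.
  destruct (rect_compact a b c d (option I)
    (fun o => match o with Some i => U i | None => fun p => ~ F p end)) as [l Hl].
  - intros [i|]; [apply HU|].
    apply open2_near; intros p Hp; now apply closed2_far.
  - intros p _; destruct (classic (F p)) as [Hp|Hp].
    + destruct (Cov p Hp) as [i Hi]; now exists (Some i).
    + now exists None.
  - exists (flat_map (fun o => match o with Some i => i :: nil | None => nil end) l).
    intros p Hp; destruct (Hl p (HR p Hp)) as [[i|] [Hi Ui]]; [|now elim Ui].
    exists i; split; auto; apply in_flat_map; exists (Some i); split; simpl; auto.
Qed.

Lemma list_positive_bound {A : Type} (s : A -> R) (l : list A) :
  exists m, 0 < m /\ forall i, In i l -> 0 < s i -> m <= s i.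
Proof.
  induction l as [|a l [m [Hm H]]].
  - exists 1; split; [lra | intros ? []].
  - destruct (Rlt_dec 0 (s a)) as [P|P].
    + exists (Rmin (s a) m); split; [now apply Rmin_pos|].
      intros i [->|Hi] Pi; [apply Rmin_l|].
      eapply Rle_trans; [apply Rmin_r | auto].
    + exists m; split; auto; intros i [->|Hi] Pi; [contradiction | auto].
Qed.

(** A Lebesgue number argument: finitely many of the given radii suffice, and [m] is a lower bound
    for them. The conclusion does not record that the centre lies in [F]; where this matters it is
    made part of [Q]. *)
Lemma compact_uniform (F : set2) (Q : R2 -> R -> Prop) : compact2 F ->
  (forall q, F q -> exists s, 0 < s /\ Q q s) ->
  exists m, 0 < m /\ forall p, F p -> exists q s, m <= s /\ Q q s /\ near s q p.
Proof.
  intros HF H.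
  destruct (HF (R2 * R)%type (fun i p => 0 < snd i /\ Q (fst i) (snd i) /\ near (snd i) (fst i) p))
    as [l Hl].
  - intros [q s]; simpl; apply open2_near; intros p [P1 [P2 P3]].
    destruct (proj1 (open2_near _) (near_open2 s q) p P3) as [e [He E]].
    exists e; split; auto.
  - intros p Hp; destruct (H p Hp) as [s [Hs Qs]]; exists (p, s); simpl.
    repeat split; auto; now apply near_refl.
  - destruct (list_positive_bound (@snd R2 R) l) as [m [Hm B]]; exists m; split; auto.
    intros p Hp; destruct (Hl p Hp) as [[q s] [Hi [P1 [P2 P3]]]]; simpl in *.
    exists q, s; split; auto; apply (B (q, s)); auto.
Qed.

Lemma compact_closed (K : set2) : compact2 K -> closed2 K.
Proof.
  intros HK p H; apply NNPP; intro Np.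
  destruct (compact_uniform K (fun q s => ~ near (s + s) q p) HK) as [m [Hm B]].
  - intros q Hq; apply NNPP; intro N; apply Np.
    replace p with q; [assumption|].
    assert (C : forall s, 0 < s -> near s q p).
    { intros s Hs; apply NNPP; intro N'; apply N; exists (s / 2); split; [lra|].
      now replace (s / 2 + s / 2) with s by field. }
    destruct q as [q1 q2], p as [p1 p2].
    f_equal; apply Rminus_diag_uniq; apply NNPP; intro Z; apply Rabs_pos_lt in Z;
      destruct (C _ Z) as [C1 C2]; simpl in *; lra.
  - destruct (H m Hm) as [q' [Hq' D]].
    destruct (B q' Hq') as [q [s [Ls [Qs Ds]]]]; apply Qs.
    apply near_trans with q'; auto; apply near_sym; now apply near_weak with m.
Qed.

Lemma compact_bounded (K : set2) : compact2 K ->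
  exists M, 0 < M /\ forall p, K p -> Rabs (snd p) < M.
Proof.
  intros HK.
  destruct (HK R (fun M p => Rabs (snd p) < M)) as [l Hl].
  - intro M; apply open2_near; intros p Hp; exists (M - Rabs (snd p)); split; [lra|].
    intros q [_ L]; pose proof (Rabs_triang_inv (snd q) (snd p)).
    rewrite (Rabs_minus_sym (snd q)) in H; lra.
  - intros p _; exists (Rabs (snd p) + 1); lra.
  - assert (exists M, 0 < M /\ forall i, In i l -> i <= M) as [M [HM B]].
    { clear Hl; induction l as [|a l [M [HM B]]]; [exists 1; split; [lra | intros ? []]|].
      exists (Rmax a M); split; [pose proof (Rmax_r a M); lra|].
      intros i [->|Hi]; [apply Rmax_l | eapply Rle_trans; [auto | apply Rmax_r]]. }
    exists M; split; auto; intros p Hp; destruct (Hl p Hp) as [i [Hi L]].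
    specialize (B i Hi); lra.
Qed.

(** The separating open sets are the unions of the neighbourhoods on which [P] is constant, taken
    around points with [P] and around points without. They may overlap, but not on [K]. *)
Lemma connected2_locally_constant (K : set2) (P : R2 -> Prop) (p q : R2) :
  connected2 K -> K p -> K q ->
  (forall u, K u -> exists e, 0 < e /\ forall v, K v -> near e u v -> (P u <-> P v)) ->
  P p -> P q.
Proof.
  intros HK Kp Kq Loc Pp; apply NNPP; intro Nq; apply HK.
  set (O := fun (Q : R2 -> Prop) v => exists u e, K u /\ Q u /\ 0 < e /\ near e u v /\
     forall w, K w -> near e u w -> (P u <-> P w)).
  assert (OO : forall Q, open2 (O Q)).
  { intro Q; apply open2_near; intros v [u [e [Ku [Qu [He [Nu L]]]]]].
    destruct (proj1 (open2_near _) (near_open2 e u) v Nu) as [e' [He' E]].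
    exists e'; split; auto; intros w Hw; exists u, e; repeat split; auto; now apply E || apply L. }
  assert (OK : forall (Q : R2 -> Prop) u, K u -> Q u -> O Q u).
  { intros Q u Ku Qu; destruct (Loc u Ku) as [e [He L]]; exists u, e; repeat split; auto.
    - rewrite Rminus_diag, Rabs_R0; assumption.
    - rewrite Rminus_diag, Rabs_R0; assumption.
    - apply L; assumption.
    - apply L; assumption. }
  exists (O P), (O (fun u => ~ P u)); repeat split; auto.
  - intros u Ku; destruct (classic (P u)); [left | right]; now apply OK.
  - exists p; split; auto.
  - exists q; split; auto.
  - intros v Kv [u [e [Ku [Qu [He [Nu L]]]]]] [u' [e' [Ku' [Qu' [He' [Nu' L']]]]]].
    apply Qu', L' with v; auto; now apply (L v).
Qed.

(** * A continuum crossing a strip separates its top from its bottom *)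

(** For points on a common horizontal or vertical line this degenerate rectangle is the segment
    between them. *)
Definition segment_box (p q : R2) : set2 :=
  rect (Rmin (fst p) (fst q)) (Rmax (fst p) (fst q)) (Rmin (snd p) (snd q)) (Rmax (snd p) (snd q)).

Inductive axis_path (X : set2) : R2 -> R2 -> Prop :=
| axis_path_refl p : X p -> axis_path X p p
| axis_path_step p q r : fst p = fst q \/ snd p = snd q ->
    (forall z, segment_box p q z -> X z) -> axis_path X q r -> axis_path X p r.

Lemma between_min_max (u v w : R) : u <= w <= v \/ v <= w <= u -> Rmin u v <= w <= Rmax u v.
Proof.
  pose proof (Rmin_l u v); pose proof (Rmin_r u v).
  pose proof (Rmax_l u v); pose proof (Rmax_r u v); lra.
Qed.

Lemma min_max_between (u v w : R) : Rmin u v <= w <= Rmax u v -> u <= w <= v \/ v <= w <= u.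
Proof.
  unfold Rmin, Rmax; destruct (Rle_dec u v); lra.
Qed.

Lemma segment_box_start (p q : R2) : segment_box p q p.
Proof. split; apply between_min_max; lra. Qed.

(** The L-shaped path with corner [(fst v, snd u)] stays in the square. *)
Lemma axis_path_in_box (X : set2) (c : R2) (e : R) (u v r : R2) :
  (forall z, near e c z -> X z) -> near e c u -> near e c v ->
  axis_path X v r -> axis_path X u r.
Proof.
  intros HX [U1 U2] [V1 V2] H; apply Rabs_def2 in U1, U2, V1, V2.
  apply axis_path_step with (fst v, snd u); [now right| |].
  - intros z [Z1 Z2]; simpl in *; apply min_max_between in Z1, Z2.
    apply HX; split; apply Rabs_def1; lra.
  - apply axis_path_step with v; [now left| |assumption].
    intros z [Z1 Z2]; simpl in *; apply min_max_between in Z1, Z2.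
    apply HX; split; apply Rabs_def1; lra.
Qed.

(** A vertex exactly at height [y] counts as below, so a path meeting the ray's level at a vertex is
    counted consistently on both adjacent edges. *)
Definition below (v : R2) (y : R) : bool := if Rle_dec (snd v) y then true else false.
Definition right_of (v : R2) (x : R) : bool := if Rlt_dec x (fst v) then true else false.

Lemma closed2_union (A B : set2) : closed2 A -> closed2 B -> closed2 (fun p => A p \/ B p).
Proof.
  intros HA HB p H; apply NNPP; intro N.
  destruct (closed2_far A p HA) as [e1 [He1 E1]]; [tauto|].
  destruct (closed2_far B p HB) as [e2 [He2 E2]]; [tauto|].
  destruct (H (Rmin e1 e2)) as [q [Hq D]]; [now apply Rmin_pos|].
  destruct Hq as [Hq|Hq]; [apply (E1 q) | apply (E2 q)]; auto; apply near_weak with (Rmin e1 e2); auto;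
    [apply Rmin_l | apply Rmin_r].
Qed.

(* [w x y] is the parity of the number of times the path crosses the horizontal ray going
   right from [(x, y)]; [T] is the trace of the path. *)
Lemma crossing_parity (X : set2) (p q : R2) : axis_path X p q ->
  exists (T : set2) (w : R -> R -> bool),
    closed2 T /\ (forall z, T z -> X z) /\
    (forall x y y', y <= y' -> (forall t, y <= t <= y' -> ~ T (x, t)) ->
       xorb (w x y) (w x y') =
       xorb (right_of p x && xorb (below p y) (below p y'))
            (right_of q x && xorb (below q y) (below q y'))) /\
    (forall x x' y, x <= x' -> (forall t, x <= t <= x' -> ~ T (t, y)) -> w x y = w x' y) /\
    (forall x y, (forall z, T z -> x < fst z) -> w x y = xorb (below p y) (below q y)) /\
    (forall x y, (forall z, T z -> fst z <= x) -> w x y = false).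
Proof.
  induction 1 as [p Hp | p q r Hax Hseg Hpath [T [w [HT [TX [V [Ho [L Ri]]]]]]]].
  - exists (segment_box p p), (fun _ _ => false); split; [apply rect_closed2|].
    repeat split; auto.
    + intros [z1 z2] [Z1 Z2]; simpl in *; apply min_max_between in Z1, Z2.
      replace (z1, z2) with p; [assumption|].
      destruct p; simpl in *; f_equal; lra.
    + intros; symmetry; apply xorb_nilpotent.
    + intros; symmetry; apply xorb_nilpotent.
  - exists (fun z => segment_box p q z \/ T z),
      (* Only a vertical edge can add a crossing: on a horizontal one [p] and [q] have the same
         height and the new term is [false]. *)
      (fun x y => xorb (right_of p x && xorb (below p y) (below q y)) (w x y)).
    split; [apply closed2_union; auto; apply rect_closed2|].
    split; [intros z [Hz|Hz]; auto|].
    split; [|split; [|split]].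
    + intros x y y' Hy N.
      assert (E := V x y y' Hy ltac:(intros t Ht C; apply (N t Ht); now right)).
      (* If the height of [q] lies between [y] and [y'], a horizontal edge passing over [x] would
         put a point of the trace on the vertical segment. *)
      assert (D : xorb (below q y) (below q y') = true -> right_of p x = right_of q x).
      { intro D; unfold right_of.
        assert (Hq : y <= snd q <= y').
        { unfold below in D; destruct (Rle_dec (snd q) y), (Rle_dec (snd q) y'); simpl in D;
            try discriminate; lra. }
        destruct Hax as [Hx|Hs]; [now rewrite Hx|].
        destruct (Rlt_dec x (fst p)), (Rlt_dec x (fst q)); auto; exfalso;
          apply (N (snd q) Hq); left; split; simpl; apply between_min_max; lra. }
      clear - E D.
      destruct (w x y), (w x y'), (right_of p x), (right_of q x), (right_of r x),
        (below p y), (below p y'), (below q y), (below q y'), (below r y), (below r y');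
        simpl in *; try discriminate; try reflexivity; discriminate (D eq_refl).
    + intros x x' y Hx N.
      rewrite (Ho x x' y Hx) by (intros t Ht C; apply (N t Ht); now right).
      f_equal.
      (* Otherwise the horizontal move would run through the point [(fst p, y)] of the new edge. *)
      assert (D : xorb (below p y) (below q y) = true -> right_of p x = right_of p x').
      { intro D; unfold right_of.
        destruct (Rlt_dec x (fst p)), (Rlt_dec x' (fst p)); auto; [|lra]; exfalso.
        apply (N (fst p)); [lra|]; left.
        unfold below in D; destruct (Rle_dec (snd p) y), (Rle_dec (snd q) y); simpl in D;
          try discriminate;
          split; simpl; apply between_min_max; lra. }
      destruct (xorb (below p y) (below q y)); [now rewrite D | now rewrite !andb_false_r].
    + intros x y N.
      rewrite L by auto.
      unfold right_of; destruct (Rlt_dec x (fst p)) as [_|C].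
      * destruct (below p y), (below q y), (below r y); reflexivity.
      * elim C; apply N; left; apply segment_box_start.
    + intros x y N; rewrite Ri by auto.
      unfold right_of; destruct (Rlt_dec x (fst p)) as [C|_]; [|reflexivity].
      specialize (N p (or_introl (segment_box_start p q))); lra.
Qed.

(** The crossing parity is locally constant on [K]: the trace misses [K], and no height occurring in
    [K] separates the ends of the path differently from another. At [u], left of the strip, it is
    odd since the ends lie on opposite sides of [K]; at [v], right of the strip, it is even. *)
Lemma no_crossing_path (K : set2) (a b M s : R) (u v p q : R2) :
  s = 1 \/ s = -1 -> connected2 K -> (forall z, K z -> Rabs (snd z) < M) ->
  K u -> K v -> fst u <= a -> b <= fst v ->
  M <= s * snd p -> s * snd q <= - M ->
  ~ axis_path (fun z => a < fst z < b /\ ~ K z) p q.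
Proof.
  intros Hs CK BK Ku Kv Hu Hv Hp Hq Path.
  destruct (crossing_parity _ _ _ Path) as [T [w [HT [TX [V [Ho [L Ri]]]]]]].
  assert (Bp : forall y y', Rabs y < M -> Rabs y' < M -> below p y = below p y').
  { intros y y' H1 H2; apply Rabs_def2 in H1, H2; unfold below.
    destruct (Rle_dec (snd p) y), (Rle_dec (snd p) y'); auto; destruct Hs; subst; lra. }
  assert (Bq : forall y y', Rabs y < M -> Rabs y' < M -> below q y = below q y').
  { intros y y' H1 H2; apply Rabs_def2 in H1, H2; unfold below.
    destruct (Rle_dec (snd q) y), (Rle_dec (snd q) y'); auto; destruct Hs; subst; lra. }
  assert (W : w (fst v) (snd v) = true).
  { apply (connected2_locally_constant K (fun z => w (fst z) (snd z) = true) u v); auto.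
    - intros z Kz.
      destruct (closed2_far T z HT) as [e [He E]]; [intro Tz; now apply (TX z)|].
      exists e; split; auto; intros z' Kz' [D1 D2].
      apply Rabs_def2 in D1, D2.
      assert (w (fst z) (snd z) = w (fst z') (snd z)) as ->.
      { destruct (Rle_dec (fst z) (fst z')); [|symmetry];
          apply Ho; try lra; intros t Ht; apply E; split; simpl; apply Rabs_def1; lra. }
      assert (xorb (w (fst z') (snd z)) (w (fst z') (snd z')) = false) as X.
      { destruct (Rle_dec (snd z) (snd z')); [|rewrite xorb_comm];
          (rewrite V; [|lra|intros t Ht; apply E; split; simpl; apply Rabs_def1; lra]);
          rewrite (Bp (snd z) (snd z')), (Bq (snd z) (snd z')), !xorb_nilpotent, !andb_false_r by auto;
          reflexivity. }
      destruct (w (fst z') (snd z)), (w (fst z') (snd z')); simpl in X; try discriminate; tauto.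
    - rewrite L by (intros z Tz; specialize (TX z Tz); simpl in TX; lra).
      assert (B := BK u Ku); apply Rabs_def2 in B; unfold below.
      destruct (Rle_dec (snd p) (snd u)), (Rle_dec (snd q) (snd u)); auto; destruct Hs; subst; lra. }
  rewrite Ri in W; [discriminate|].
  intros z Tz; specialize (TX z Tz); simpl in TX; lra.
Qed.

Lemma connected_meets_vertical (K : set2) (u v : R2) (x : R) : connected2 K -> K u -> K v ->
  fst u <= x <= fst v -> exists y, K (x, y).
Proof.
  intros CK Ku Kv Hx; apply NNPP; intro N.
  assert (Ne : forall z, K z -> fst z <> x).
  { intros [z1 z2] Kz E; simpl in E; subst; apply N; now exists z2. }
  assert (fst v < x).
  { apply (connected2_locally_constant K (fun z => fst z < x) u v); auto.
    - intros z Kz; exists (Rabs (fst z - x)); split.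
      + apply Rabs_pos_lt; specialize (Ne z Kz); lra.
      + intros z' Kz' [D _]; apply Rabs_def2 in D.
        unfold Rabs in D; destruct (Rcase_abs (fst z - x)); lra.
    - specialize (Ne u Ku); lra. }
  lra.
Qed.

(* The part of the graph on the far side of [K] between two vertical lines, on which the graph
   passes on the near side of [K], is open and closed in the graph. *)
Lemma barrier_disconnects (f : R -> R) (K : set2) (a b s : R) (u v : R2) :
  s = 1 \/ s = -1 -> compact2 K -> connected2 K ->
  (forall p, K p -> interior2 (closure2 (graph f)) p) ->
  (forall p, graph f p -> ~ K p) ->
  K u -> K v -> fst u <= a -> b <= fst v -> a < b ->
  (forall l r C, a <= l -> l < r -> r <= b -> exists x, l < x < r /\ C < s * f x) ->
  ~ connected2 (graph f).
Proof.
  intros Hs CpK CK IK GK Ku Kv Hu Hv Hab Unb CG.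
  destruct (compact_bounded K CpK) as [M [HM BK]].
  pose proof (compact_closed K CpK) as ClK.
  set (d := (b - a) / 3).
  destruct (Unb a (a + d) M) as [c1 [H1 F1]]; [lra|unfold d; lra|unfold d; lra|].
  destruct (Unb (b - d) b M) as [c2 [H2 F2]]; [unfold d; lra|unfold d; lra|lra|].
  set (x0 := (a + b) / 2).
  assert (Hx0 : c1 < x0 < c2) by (unfold x0, d in *; lra).
  set (X := fun z : R2 => a < fst z < b /\ ~ K z).
  assert (OX : forall z, X z -> exists e, 0 < e /\ forall q, near e z q -> X q).
  { intros z [Hz Nz]; destruct (closed2_far K z ClK Nz) as [e [He E]].
    exists (Rmin e (Rmin (fst z - a) (b - fst z))).
    pose proof (Rmin_l e (Rmin (fst z - a) (b - fst z))).
    pose proof (Rmin_r e (Rmin (fst z - a) (b - fst z))).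
    pose proof (Rmin_l (fst z - a) (b - fst z)); pose proof (Rmin_r (fst z - a) (b - fst z)).
    split; [repeat apply Rmin_pos; lra|].
    intros q Hq; split; [|apply E; eapply near_weak; [exact Hq|lra]].
    destruct Hq as [Hq _]; apply Rabs_def2 in Hq; lra. }
  (* Lying on the far side of [K] is expressed by a path off [K], within the strip, to a level
     beyond [K] in the direction [- s]. *)
  set (P := fun x => c1 < x < c2 /\ exists q, s * snd q <= - M /\ axis_path X (x, f x) q).
  assert (NP : forall x, M < s * f x -> ~ P x).
  { intros x Hx [_ [q [Hq Path]]].
    revert Path; apply (no_crossing_path K a b M s u v); auto; simpl; lra. }
  assert (Gx : forall x, graph f (x, f x)) by (intro; reflexivity).
  assert (exists x, P x) as [x1 Px1].
  { destruct (connected_meets_vertical K u v x0 CK Ku Kv) as [y0 Ky0]; [unfold d in *; lra|].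
    assert (Ss : s * s = 1) by (destruct Hs; subst; ring).
    assert (As : forall t, Rabs (s * t) = Rabs t).
    { intro t; destruct Hs; subst; [now rewrite Rmult_1_l|].
      replace (-1 * t) with (- t) by ring; apply Rabs_Ropp. }
    assert (Asm : forall t, Rabs (- s * t) = Rabs t).
    { intro t; replace (- s * t) with (- (s * t)) by ring; rewrite Rabs_Ropp; apply As. }
    (* [T] locates the extreme point of [K] on the line [x0] in the direction [- s]. *)
    destruct (completeness (fun t => K (x0, - s * t))) as [T [U1 U2]].
    - exists M; intros t Kt; specialize (BK _ Kt); simpl in BK; rewrite Asm in BK.
      apply Rabs_def2 in BK; lra.
    - exists (- s * y0); replace (- s * (- s * y0)) with (s * s * y0) by ring.
      now rewrite Ss, Rmult_1_l.
    - assert (KT : K (x0, - s * T)).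
      { apply ClK; intros e He.
        assert (exists t, K (x0, - s * t) /\ T - e < t) as [t [Kt Lt]].
        { apply NNPP; intro N; assert (T <= T - e); [|lra].
          apply U2; intros t Kt; apply Rnot_lt_le; intro; apply N; now exists t. }
        specialize (U1 t Kt).
        exists (x0, - s * t); split; auto; split; simpl.
        - rewrite Rminus_diag, Rabs_R0; exact He.
        - replace (- s * T - - s * t) with (- s * (T - t)) by ring; rewrite Asm.
          apply Rabs_def1; lra. }
      assert (Above : forall t, T < t -> ~ K (x0, - s * t)).
      { intros t Ht Kt; specialize (U1 t Kt); lra. }
      destruct (proj1 (interior2_near _ _) (IK _ KT)) as [e [He E]].
      (* Just beyond the extreme point the graph is still dense, and the vertical ray from [q] leads
         past level [M] without meeting [K]. *)
      set (q := (x0, - s * (T + e / 2)) : R2).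
      assert (Xq : X q).
      { split; [simpl; unfold d in *; lra|]; apply Above; lra. }
      assert (Gq : closure2 (graph f) q).
      { apply E; split; simpl.
        - rewrite Rminus_diag, Rabs_R0; exact He.
        - replace (- s * T - - s * (T + e / 2)) with (s * (e / 2)) by ring; rewrite As.
          apply Rabs_def1; lra. }
      destruct (OX q Xq) as [e1 [He1 E1]].
      destruct (proj1 (closure2_near _ _) Gq (Rmin e1 (Rmin (x0 - c1) (c2 - x0)))) as [[x y] [G N]];
        [repeat apply Rmin_pos; lra|].
      unfold graph in G; simpl in G; subst y.
      pose proof (Rmin_l e1 (Rmin (x0 - c1) (c2 - x0))).
      pose proof (Rmin_r e1 (Rmin (x0 - c1) (c2 - x0))).
      pose proof (Rmin_l (x0 - c1) (c2 - x0)); pose proof (Rmin_r (x0 - c1) (c2 - x0)).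
      exists x; split.
      + destruct N as [N _]; simpl in N; apply Rabs_def2 in N; lra.
      + set (t1 := Rmax (T + e / 2) M).
        pose proof (Rmax_l (T + e / 2) M : _ <= t1) as Ht1.
        pose proof (Rmax_r (T + e / 2) M : _ <= t1) as Ht1'.
        exists (x0, - s * t1); split.
        { simpl; replace (s * (- s * t1)) with (- (s * s) * t1) by ring; rewrite Ss; lra. }
        apply (axis_path_in_box X q e1 (x, f x) q); auto.
        * eapply near_weak; [exact N|lra].
        * now apply near_refl.
        * assert (Ax : forall z, segment_box q (x0, - s * t1) z -> X z).
          { intros [z1 z2] [Z1 Z2]; simpl in Z1, Z2; apply min_max_between in Z1, Z2.
            assert (z1 = x0) by lra; subst z1.
            split; [simpl; unfold d in *; lra|].
            replace z2 with (- s * (- s * z2))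
              by (replace (- s * (- s * z2)) with (s * s * z2) by ring; rewrite Ss; ring).
            apply Above; destruct Hs; subst; lra. }
          apply axis_path_step with (x0, - s * t1); [now left|exact Ax|].
          apply axis_path_refl; apply Ax; split; apply between_min_max; simpl; lra. }
  assert (C : P c1); [|destruct C as [C _]; lra].
  apply (connected2_locally_constant (graph f) (fun z => P (fst z)) (x1, f x1) (c1, f c1)); auto.
  intros [x y] G; unfold graph in G; simpl in G; subst y.
  (* The boundary abscissae [c1] and [c2] fall under the third case, because the graph passes beyond
     [K] there on the near side. *)
  assert (Out : x < c1 \/ c2 < x \/ M < s * f x \/ c1 < x < c2).
  { destruct (Rtotal_order x c1) as [|[->|]]; auto.
    destruct (Rtotal_order x c2) as [|[->|]]; auto. }
  destruct Out as [Hx|[Hx|[Hx|Hx]]].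
  - exists (c1 - x); split; [lra|]; intros [x' y'] _ [D _]; simpl in *; apply Rabs_def2 in D.
    split; intros [? _]; lra.
  - exists (x - c2); split; [lra|]; intros [x' y'] _ [D _]; simpl in *; apply Rabs_def2 in D.
    split; intros [? _]; lra.
  - exists (s * f x - M); split; [lra|]; intros [x' y'] G [_ D].
    unfold graph in G; simpl in *; subst y'; apply Rabs_def2 in D.
    split; intro Q; [now elim (NP x)|].
    elim (NP x'); auto; destruct Hs; subst; lra.
  - destruct (OX (x, f x)) as [e [He E]].
    { split; [simpl; unfold d in *; lra | now apply GK]. }
    exists (Rmin e (Rmin (x - c1) (c2 - x))).
    pose proof (Rmin_l e (Rmin (x - c1) (c2 - x))).
    pose proof (Rmin_r e (Rmin (x - c1) (c2 - x))).
    pose proof (Rmin_l (x - c1) (c2 - x)); pose proof (Rmin_r (x - c1) (c2 - x)).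
    split; [repeat apply Rmin_pos; lra|].
    intros [x' y'] G D; unfold graph in G; simpl in G; subst y'.
    assert (D1 := proj1 D); simpl in D1; apply Rabs_def2 in D1.
    assert (De : near e (x, f x) (x', f x')) by (eapply near_weak; [exact D|lra]).
    simpl; split; intros [_ [q [Hq Path]]]; (split; [lra|]); exists q; split; auto.
    + now apply (axis_path_in_box X (x, f x) e _ (x, f x)); [|assumption|now apply near_refl|].
    + now apply (axis_path_in_box X (x, f x) e _ (x', f x')); [|now apply near_refl|assumption|].
Qed.

(** * A closed set separating top from bottom contains a crossing continuum *)

Inductive chain (F : set2) (e : R) (p : R2) : R2 -> Prop :=
| chain_refl : F p -> chain F e p p
| chain_snoc q r : chain F e p q -> F r -> near e q r -> chain F e p r.

Lemma chain_end (F : set2) (e : R) (p q : R2) : chain F e p q -> F q.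
Proof. now destruct 1. Qed.

Lemma chain_start (F : set2) (e : R) (p q : R2) : chain F e p q -> F p.
Proof. induction 1; auto. Qed.

Lemma chain_weak (F : set2) (e e' : R) (p q : R2) : e <= e' -> chain F e p q -> chain F e' p q.
Proof.
  intros L; induction 1 as [|q r _ IH Hr N]; [now apply chain_refl|].
  apply chain_snoc with q; auto; now apply near_weak with e.
Qed.

Lemma chain_prepend (F : set2) (e : R) (l p q : R2) :
  F l -> near e l p -> chain F e p q -> chain F e l q.
Proof.
  intros Hl N; induction 1 as [Hp|q r _ IH Hr N'].
  - apply chain_snoc with l; auto; now apply chain_refl.
  - now apply chain_snoc with q.
Qed.

(** Suppose [O1] and [O2] split the set and [l] is in [O1]. By compactness there is a scale [m] such
    that every point of [F] lies, with all points within [m], well inside [O1], well inside [O2], or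
    where no [m]-chain from [l] ends. An [m]-chain from [l] then never leaves [O1]. *)
Lemma chain_component_connected (F : set2) (l : R2) : compact2 F ->
  connected2 (fun p => forall e, 0 < e -> chain F e l p).
Proof.
  intros CF; set (K := fun p => forall e, 0 < e -> chain F e l p).
  assert (Main : forall O1 O2 : set2, open2 O1 -> open2 O2 ->
    (forall p, K p -> O1 p \/ O2 p) -> (forall p, K p -> O1 p -> O2 p -> False) ->
    K l -> O1 l -> forall p, K p -> O2 p -> False).
  { intros O1 O2 H1 H2 Cov Dis Kl Ol p Kp Op.
    (* [O1] and [O2] are disjoint only on [K]. Squares of half the radius around points of [K] are
       disjoint everywhere, since of two that meet, one centre lies in the larger full square around
       the other. *)
    set (shrink := fun (O : set2) z => exists c e, K c /\ O c /\ 0 < e /\ near (e / 2) c z /\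
       forall w, near e c w -> O w).
    assert (Sh : forall O, open2 O -> forall c, K c -> O c ->
      exists s, 0 < s /\ forall w, near (s + s) c w -> shrink O w).
    { intros O HO c Kc Oc; destruct (proj1 (open2_near _) HO c Oc) as [e [He E]].
      exists (e / 4); split; [lra|]; intros w Hw; exists c, e; repeat split; auto;
        destruct Hw; lra. }
    assert (DisS : forall z, shrink O1 z -> shrink O2 z -> False).
    { intros z [c [e [Kc [Oc [He [Nc E]]]]]] [c' [e' [Kc' [Oc' [He' [Nc' E']]]]]].
      assert (N := near_trans _ _ _ _ _ Nc (near_sym _ _ _ Nc')).
      destruct (Rle_dec e' e).
      - apply (Dis c'); auto; apply E; eapply near_weak; [exact N|lra].
      - apply (Dis c); auto; apply E', near_sym; eapply near_weak; [exact N|lra]. }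
    destruct (compact_uniform F (fun q s =>
      (forall w, near (s + s) q w -> shrink O1 w) \/ (forall w, near (s + s) q w -> shrink O2 w) \/
      (forall w, near (s + s) q w -> ~ chain F s l w)) CF) as [m [Hm B]].
    - intros q Fq; destruct (classic (K q)) as [Kq|Nq].
      + destruct (Cov q Kq) as [Oq|Oq];
          [destruct (Sh O1 H1 q Kq Oq) as [s [Hs E]] | destruct (Sh O2 H2 q Kq Oq) as [s [Hs E]]];
          exists s; auto.
      + apply not_all_ex_not in Nq; destruct Nq as [e Ne].
        apply imply_to_and in Ne; destruct Ne as [He Ne].
        exists (e / 2); split; [lra|]; right; right; intros w Hw Cw; apply Ne.
        apply chain_snoc with w; [apply chain_weak with (e / 2); [lra|assumption]|assumption|].
        apply near_sym; eapply near_weak; [exact Hw|lra].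
    - assert (Ind : forall w, chain F m l w -> shrink O1 w).
      { induction 1 as [Fl|q r Cq IH Fr N].
        - destruct (Sh O1 H1 l Kl Ol) as [s [Hs E]]; apply E, near_refl; lra.
        - destruct (B q (chain_end _ _ _ _ Cq)) as [c [s [Ls [Q Nc]]]].
          assert (Nq : near (s + s) c q) by (eapply near_weak; [exact Nc|lra]).
          assert (Nr : near (s + s) c r).
          { apply near_trans with q; auto; eapply near_weak; [exact N|lra]. }
          destruct Q as [Q|[Q|Q]]; auto.
          + elim (DisS q); auto.
          + elim (Q q Nq); now apply chain_weak with m. }
      apply (DisS p); [now apply Ind, Kp|].
      destruct (Sh O2 H2 p Kp Op) as [s [Hs E]]; apply E, near_refl; lra. }
  intros [O1 [O2 [H1 [H2 [Cov [[p [Kp Op]] [[q [Kq Oq]] Dis]]]]]]].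
  assert (Kl : K l) by (intros e He; apply chain_refl, (chain_start F 1 l p), Kp; lra).
  destruct (Cov l Kl) as [Ol|Ol].
  - now apply (Main O1 O2) with q.
  - apply (Main O2 O1) with p; auto.
    + intros z Kz; destruct (Cov z Kz); auto.
    + intros z Kz Z2 Z1; now apply (Dis z).
Qed.

Lemma chain_component_closed (F : set2) (l : R2) : closed2 F ->
  closed2 (fun p => forall e, 0 < e -> chain F e l p).
Proof.
  intros HF p H e He.
  destruct (H e He) as [q [Cq N]].
  apply chain_snoc with q; [now apply Cq| |now apply near_sym].
  apply HF; intros e' He'; destruct (H e' He') as [r [Cr Nr]]; exists r; split; auto.
  apply (chain_end F e l), Cr, He.
Qed.

(** The left end is fixed first, then the right end for that left end. If every candidate failed at
    some scale, compactness would give one scale at which all fail. *)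
Lemma chain_limit_endpoints (F : set2) (l' r' : R) : compact2 F ->
  (forall e, 0 < e -> exists l r, chain F e l r /\ fst l <= l' /\ r' <= fst r) ->
  exists l r, fst l <= l' /\ r' <= fst r /\ forall e, 0 < e -> chain F e l r.
Proof.
  intros CF H.
  assert (exists l, fst l <= l' /\ forall e, 0 < e -> exists r, chain F e l r /\ r' <= fst r)
    as [l [Hl L]].
  { apply NNPP; intro N.
    destruct (compact_uniform F (fun q s => (forall w, near s q w -> l' < fst w) \/
      (F q /\ forall r, r' <= fst r -> ~ chain F s q r)) CF) as [m [Hm B]].
    - intros q Fq; destruct (Rle_dec (fst q) l') as [Lq|Lq].
      + apply NNPP; intro N'; apply N; exists q; split; auto; intros e He.
        apply NNPP; intro N2; apply N'; exists e; split; auto; right; split; auto.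
        intros r Hr Cr; apply N2; now exists r.
      + exists (fst q - l'); split; [lra|]; left; intros w [D _]; apply Rabs_def2 in D; lra.
    - destruct (H m Hm) as [l [r [Cr [L1 L2]]]].
      destruct (B l (chain_start _ _ _ _ Cr)) as [q [s [Ls [[Q|[Fq Q]] Nq]]]].
      + specialize (Q l Nq); lra.
      + apply (Q r L2); apply chain_prepend with l; auto; now apply chain_weak with m. }
  exists l; apply NNPP; intro N.
  destruct (compact_uniform F (fun q s => (forall w, near s q w -> fst w < r') \/
      (F q /\ ~ chain F s l q)) CF) as [m [Hm B]].
  - intros q Fq; destruct (Rle_dec r' (fst q)) as [Lq|Lq].
    + apply NNPP; intro N'; apply N; exists q; repeat split; auto; intros e He.
      apply NNPP; intro N2; apply N'; exists e; split; auto.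
    + exists (r' - fst q); split; [lra|]; left; intros w [D _]; apply Rabs_def2 in D; lra.
  - destruct (L m Hm) as [r [Cr Lr]].
    destruct (B r (chain_end _ _ _ _ Cr)) as [q [s [Ls [[Q|[Fq Q]] Nq]]]].
    + specialize (Q r Nq); lra.
    + apply Q, chain_snoc with r; [now apply chain_weak with m|assumption|now apply near_sym].
Qed.

(** * A parity argument on a grid *)

Fixpoint xor_sum (n : nat) (g : nat -> bool) : bool :=
  match n with O => false | S m => xorb (xor_sum m g) (g m) end.

Lemma xor_sum_ext (n : nat) (g h : nat -> bool) :
  (forall k, (k < n)%nat -> g k = h k) -> xor_sum n g = xor_sum n h.
Proof.
  induction n as [|n IH]; intro H; simpl; [reflexivity|].
  rewrite IH, H; auto.
Qed.

Lemma xor_sum_xorb (n : nat) (g h : nat -> bool) :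
  xorb (xor_sum n g) (xor_sum n h) = xor_sum n (fun k => xorb (g k) (h k)).
Proof.
  induction n as [|n IH]; simpl; [reflexivity|].
  rewrite <- IH; destruct (xor_sum n g), (xor_sum n h), (g n), (h n); reflexivity.
Qed.

(* [T i j] selects cells of a grid with columns [0 .. N] and rows [0 .. M], and [a i j] colours
   the vertex at the lower left corner of cell [(i, j)].  If the endpoints of every edge between
   a selected and an unselected cell agree in colour, then the parity of the number of such
   edges leaving row [j] upwards from a vertex of colour [true] does not depend on [j]. *)
Lemma grid_parity (N M : nat) (T a : nat -> nat -> bool) :
  (forall j, (j <= M)%nat -> T 0%nat j = true) ->
  (forall j, (j <= M)%nat -> T N j = false) ->
  (forall k j, (k < N)%nat -> (j <= M)%nat -> T k j <> T (S k) j -> a (S k) j = a (S k) (S j)) ->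
  (forall i j, (i <= N)%nat -> (j < M)%nat -> T i j <> T i (S j) -> a i (S j) = a (S i) (S j)) ->
  (forall i, (i <= N)%nat -> a i 0%nat = true) ->
  (forall i, (i <= N)%nat -> a i (S M) = false) ->
  False.
Proof.
  intros TL TR EV EH Bot Top.
  set (row := fun j => xor_sum N (fun k => a (S k) j && xorb (T k j) (T (S k) j))).
  set (row' := fun j => xor_sum N (fun k => a (S k) (S j) && xorb (T k j) (T (S k) j))).
  assert (RR : forall j, (j <= M)%nat -> row j = row' j).
  { intros j Hj; apply xor_sum_ext; intros k Hk.
    destruct (bool_dec (T k j) (T (S k) j)) as [E|E].
    - rewrite E, xorb_nilpotent, !andb_false_r; reflexivity.
    - now rewrite (EV k j Hk Hj E). }
  assert (Step : forall j, (j < M)%nat -> row (S j) = row' j).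
  { intros j Hj; apply xorb_eq; unfold row, row'; rewrite xor_sum_xorb.
    (* Around a vertex the selection changes an even number of times, so its two vertical edges can
       be traded for its two horizontal ones. Horizontal edges where the selection changes have
       equally coloured ends, hence the sum telescopes to the outer columns, where [h] is
       [false]. *)
    set (h := fun i => xorb (T i j) (T i (S j))).
    assert (Tel : forall m, (m <= N)%nat ->
      xor_sum m (fun k => xorb (a (S k) (S j) && xorb (T k (S j)) (T (S k) (S j)))
                               (a (S k) (S j) && xorb (T k j) (T (S k) j))) =
      xorb (a 1%nat (S j) && h 0%nat) (a (S m) (S j) && h m)).
    { induction m as [|m IH]; intro Hm; [symmetry; apply xorb_nilpotent|].
      cbn [xor_sum]; rewrite IH by lia.
      assert (E : a (S m) (S j) && h (S m) = a (S (S m)) (S j) && h (S m)).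
      { unfold h; destruct (bool_dec (T (S m) j) (T (S m) (S j))) as [E|E].
        - rewrite E, xorb_nilpotent, !andb_false_r; reflexivity.
        - now rewrite (EH (S m) j Hm Hj E). }
      rewrite <- E; unfold h; clear.
      destruct (a 1%nat (S j)), (a (S m) (S j)), (T m j), (T m (S j)), (T (S m) j), (T (S m) (S j)),
        (T 0%nat j), (T 0%nat (S j)); reflexivity. }
    rewrite Tel by lia; unfold h.
    rewrite !TL, !TR by lia; simpl; now rewrite !andb_false_r. }
  assert (Const : forall j, (j <= M)%nat -> row j = row 0%nat).
  { induction j as [|j IH]; intro Hj; [reflexivity|].
    rewrite Step, <- RR, IH by lia; reflexivity. }
  (* On the bottom every colour is [true], so the row counts the changes of selection between a
     selected first and an unselected last column. *)
  assert (R0 : row 0%nat = true).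
  { unfold row.
    rewrite (xor_sum_ext N _ (fun k => xorb (T k 0%nat) (T (S k) 0%nat)))
      by (intros k Hk; rewrite Bot by lia; reflexivity).
    assert (Tel : forall m, xor_sum m (fun k => xorb (T k 0%nat) (T (S k) 0%nat)) =
      xorb (T 0%nat 0%nat) (T m 0%nat)).
    { induction m as [|m IH]; [symmetry; apply xorb_nilpotent|].
      cbn [xor_sum]; rewrite IH.
      destruct (T 0%nat 0%nat), (T m 0%nat), (T (S m) 0%nat); reflexivity. }
    rewrite Tel, TL, TR by lia; reflexivity. }
  assert (RM : row' M = false).
  { unfold row'.
    rewrite (xor_sum_ext N _ (fun _ => false)) by (intros k Hk; rewrite Top by lia; reflexivity).
    clear; induction N as [|N IH]; simpl; [|rewrite IH]; reflexivity. }
  rewrite <- RR, Const, R0 in RM by lia; discriminate.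
Qed.

(** On an edge missing the intersection, [A] and [B] are complementary and closed, hence both
    relatively open. The parametrisation [g] treats horizontal and vertical edges alike. *)
Lemma same_side_on_edge (A B : set2) (g : R -> R2) (u v : R) : closed2 A -> closed2 B -> u <= v ->
  (forall s t e, 0 < e -> Rabs (s - t) < e -> near e (g s) (g t)) ->
  (forall s, u <= s <= v -> A (g s) \/ B (g s)) ->
  (forall s, u <= s <= v -> A (g s) -> B (g s) -> False) ->
  (A (g u) <-> A (g v)).
Proof.
  intros HA HB Huv Hg Cov Dis.
  apply (segment_connected (fun s => A (g s)) u v Huv).
  intros s Hs; destruct (classic (A (g s))) as [As|Ns].
  - destruct (closed2_far B (g s) HB) as [e [He E]]; [now intro; apply (Dis s)|].
    exists e; split; auto; intros t Ht D.
    assert (~ B (g t)) by (apply E; now apply Hg).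
    destruct (Cov t Ht); tauto.
  - destruct (closed2_far A (g s) HA Ns) as [e [He E]].
    exists e; split; auto; intros t Ht D.
    assert (~ A (g t)) by (apply E; now apply Hg); tauto.
Qed.

(** Assume that no such chain exists and take a grid finer than [e]. Select the first column and
    every cell containing the end of an [e]-chain that starts in the left third. A point of [A] and
    [B] on an edge between a selected and an unselected cell would prolong a chain or start one, so
    membership in [A] is constant on such edges, against [grid_parity]. *)
Lemma crossing_chain (A B : set2) (l r b t e : R) : closed2 A -> closed2 B -> l < r -> b < t ->
  (forall p, rect l r b t p -> A p \/ B p) ->
  (forall x, l <= x <= r -> ~ B (x, b)) -> (forall x, l <= x <= r -> ~ A (x, t)) -> 0 < e ->
  exists p q, chain (fun p => rect l r b t p /\ A p /\ B p) e p q /\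
    fst p <= l + (r - l) / 3 /\ r - (r - l) / 3 <= fst q.
Proof.
  intros HA HB Hlr Hbt Cov Bot Top He.
  set (F := fun p => rect l r b t p /\ A p /\ B p).
  apply NNPP; intro NC.
  set (F1 := fun p => exists q, fst q <= l + (r - l) / 3 /\ chain F e q p).
  destruct (INR_archimed e (r - l) He) as [n0 Hn0].
  destruct (INR_archimed e (t - b) He) as [M Hm0].
  (* There are [S N = n0 + 3] columns, so that the first lies in the left third and the last in the
     right third. *)
  set (N := S (S n0)).
  set (dx := (r - l) / INR (S N)); set (dy := (t - b) / INR (S M)).
  assert (PN : 0 < INR (S N)) by (apply lt_0_INR; lia).
  assert (PM : 0 < INR (S M)) by (apply lt_0_INR; lia).
  assert (Edx : INR (S N) * dx = r - l) by (unfold dx; field; lra).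
  assert (Edy : INR (S M) * dy = t - b) by (unfold dy; field; lra).
  assert (Pdx : 0 < dx) by (apply Rdiv_lt_0_compat; lra).
  assert (Pdy : 0 < dy) by (apply Rdiv_lt_0_compat; lra).
  assert (INR (S N) = INR n0 + 3) as EN by (unfold N; rewrite !S_INR; ring).
  assert (Ldx : dx < e).
  { apply Rmult_lt_reg_l with (INR (S N)); auto; rewrite Edx, EN.
    apply Rlt_le_trans with (INR n0 * e); [lra|apply Rmult_le_compat_r; lra]. }
  assert (Ldy : dy < e).
  { apply Rmult_lt_reg_l with (INR (S M)); auto; rewrite Edy, S_INR.
    apply Rlt_le_trans with (INR M * e); [lra|apply Rmult_le_compat_r; lra]. }
  assert (Tdx : dx <= (r - l) / 3).
  { pose proof (pos_INR n0).
    assert (3 * dx <= INR (S N) * dx) by (apply Rmult_le_compat_r; lra); lra. }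
  set (X := fun i => l + INR i * dx); set (Y := fun j => b + INR j * dy).
  assert (XS : forall i, X (S i) = X i + dx) by (intro i; unfold X; rewrite S_INR; ring).
  assert (YS : forall j, Y (S j) = Y j + dy) by (intro j; unfold Y; rewrite S_INR; ring).
  assert (X0 : X 0%nat = l) by (unfold X; simpl; ring).
  assert (Y0 : Y 0%nat = b) by (unfold Y; simpl; ring).
  assert (XN : X (S N) = r) by (unfold X; lra).
  assert (YM : Y (S M) = t) by (unfold Y; lra).
  assert (Xr : forall i, (i <= S N)%nat -> l <= X i <= r).
  { intros i Hi; apply le_INR in Hi; pose proof (pos_INR i).
    assert (0 <= INR i * dx) by (apply Rmult_le_pos; lra).
    assert (INR i * dx <= INR (S N) * dx) by (apply Rmult_le_compat_r; lra).
    unfold X; lra. }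
  assert (Yr : forall j, (j <= S M)%nat -> b <= Y j <= t).
  { intros j Hj; apply le_INR in Hj; pose proof (pos_INR j).
    assert (0 <= INR j * dy) by (apply Rmult_le_pos; lra).
    assert (INR j * dy <= INR (S M) * dy) by (apply Rmult_le_compat_r; lra).
    unfold Y; lra. }
  set (cell := fun i j => rect (X i) (X (S i)) (Y j) (Y (S j))).
  set (sel := fun i j => i = 0%nat \/ exists p, F1 p /\ cell i j p).
  set (T := fun i j => if excluded_middle_informative (sel i j) then true else false).
  set (a := fun i j => if excluded_middle_informative (A (X i, Y j)) then true else false).
  assert (Ta : forall i j i' j', (A (X i, Y j) <-> A (X i', Y j')) -> a i j = a i' j').
  { intros i j i' j' H; unfold a.
    destruct (excluded_middle_informative (A (X i, Y j))),
      (excluded_middle_informative (A (X i', Y j'))); tauto. }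
  assert (Edge1 : forall i j i' j', sel i j -> ~ sel i' j' ->
    forall p, cell i j p -> cell i' j' p -> ~ F p).
  { intros i j i' j' S1 S2 p C1 C2 Fp; apply S2.
    right; exists p; split; auto.
    destruct S1 as [->|[p1 [[q [Hq Cq]] Cp1]]].
    - exists p; split; [|now apply chain_refl].
      destruct C1 as [C1 _]; rewrite XS, X0 in C1; lra.
    - exists q; split; auto; apply chain_snoc with p1; auto.
      destruct C1 as [C1 C1'], Cp1 as [C3 C4]; rewrite XS in *; rewrite YS in *.
      split; apply Rabs_def1; lra. }
  assert (Edge : forall i j i' j', T i j <> T i' j' ->
    forall p, cell i j p -> cell i' j' p -> ~ F p).
  { intros i j i' j' H p C1 C2; unfold T in H.
    destruct (excluded_middle_informative (sel i j)), (excluded_middle_informative (sel i' j'));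
      try congruence; [now apply (Edge1 i j i' j') | now apply (Edge1 i' j' i j)]. }
  apply (grid_parity N M T a).
  - intros j _; unfold T; destruct (excluded_middle_informative (sel 0%nat j)) as [|H]; auto.
    elim H; now left.
  - intros j _; unfold T; destruct (excluded_middle_informative (sel N j)) as [H|]; auto.
    destruct H as [H|[p [[q [Hq Cq]] [Cp _]]]]; [discriminate|].
    elim NC; exists q, p; repeat split; auto.
    rewrite XN in Cp; pose proof (XS N); lra.
  - intros k j Hk Hj H; apply Ta.
    apply (same_side_on_edge A B (fun s => (X (S k), s)) (Y j) (Y (S j)) HA HB).
    + rewrite YS; lra.
    + intros s s' e' He' D; split; simpl; auto; rewrite Rminus_diag, Rabs_R0; assumption.
    + intros s Hs; apply Cov; pose proof (Xr (S k) ltac:(lia)).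
      pose proof (Yr j ltac:(lia)); pose proof (Yr (S j) ltac:(lia)); split; simpl; lra.
    + intros s Hs As Bs.
      apply (Edge k j (S k) j H (X (S k), s)).
      * pose proof (XS k); split; simpl; lra.
      * pose proof (XS (S k)); split; simpl; lra.
      * pose proof (Xr (S k) ltac:(lia)).
        pose proof (Yr j ltac:(lia)); pose proof (Yr (S j) ltac:(lia)).
        repeat split; simpl; auto; lra.
  - intros i j Hi Hj H; apply Ta.
    apply (same_side_on_edge A B (fun s => (s, Y (S j))) (X i) (X (S i)) HA HB).
    + rewrite XS; lra.
    + intros s s' e' He' D; split; simpl; auto; rewrite Rminus_diag, Rabs_R0; assumption.
    + intros s Hs; apply Cov; pose proof (Yr (S j) ltac:(lia)).
      pose proof (Xr i ltac:(lia)); pose proof (Xr (S i) ltac:(lia)); split; simpl; lra.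
    + intros s Hs As Bs.
      apply (Edge i j i (S j) H (s, Y (S j))).
      * pose proof (YS j); split; simpl; lra.
      * pose proof (YS (S j)); split; simpl; lra.
      * pose proof (Yr (S j) ltac:(lia)).
        pose proof (Xr i ltac:(lia)); pose proof (Xr (S i) ltac:(lia)).
        repeat split; simpl; auto; lra.
  - intros i Hi; unfold a; rewrite Y0.
    destruct (excluded_middle_informative (A (X i, b))) as [|C]; auto.
    pose proof (Xr i ltac:(lia)).
    destruct (Cov (X i, b)); [split; simpl; lra|contradiction|].
    now elim (Bot (X i)).
  - intros i Hi; unfold a; rewrite YM.
    destruct (excluded_middle_informative (A (X i, t))) as [C|]; auto.
    elim (Top (X i)); [apply Xr; lia|assumption].
Qed.

(** Chains of every fineness run from the left third to the right third; compactness makes their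
    ends independent of the fineness, and the points chained to the left end at every scale form the
    continuum. *)
Lemma crossing_continuum (A B : set2) (l r b t : R) : closed2 A -> closed2 B -> l < r -> b < t ->
  (forall p, rect l r b t p -> A p \/ B p) ->
  (forall x, l <= x <= r -> ~ B (x, b)) -> (forall x, l <= x <= r -> ~ A (x, t)) ->
  exists K, continuum K /\ touches_two_vertical_lines K /\
    forall p, K p -> rect l r b t p /\ A p /\ B p.
Proof.
  intros HA HB Hlr Hbt Cov Bot Top.
  set (F := fun p => rect l r b t p /\ A p /\ B p).
  assert (HF : closed2 F).
  { apply closed2_inter; [apply rect_closed2 | now apply closed2_inter]. }
  assert (CF : compact2 F) by (apply (closed_compact F l r b t HF); now intros p [? _]).
  destruct (chain_limit_endpoints F (l + (r - l) / 3) (r - (r - l) / 3) CF)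
    as [p [q [Hp [Hq C]]]].
  { intros e He; destruct (crossing_chain A B l r b t e) as [p [q H]]; auto; now exists p, q. }
  set (K := fun z => forall e, 0 < e -> chain F e p z).
  assert (KF : forall z, K z -> F z) by (intros z Kz; apply (chain_end F 1 p), Kz; lra).
  assert (Kp : K p) by (intros e He; apply chain_refl, (chain_start F e p q), C, He).
  assert (Hpq : fst p <> fst q) by lra.
  exists K; split; [|split; [now exists p, q | exact KF]].
  split; [|split].
  - apply (closed_compact K l r b t); [now apply chain_component_closed|].
    intros z Kz; apply (KF z Kz).
  - now apply chain_component_connected.
  - exists p, q; repeat split; auto; now intros ->.
Qed.

(** * The region filled by the graph *)

Definition slope_between (n : nat) (f : R -> R) (z : R) : Prop :=
  exists x1 x2, 0 < x1 /\ 0 < x2 /\ slope n f x1 < z < slope n f x2.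

(** An explicit part of the interior of the closure of the graph; the strict bounds make it open,
    and it meets each vertical line in a convex set. *)
Definition slope_region (n : nat) (f : R -> R) : set2 :=
  fun p => fst p <> 0 /\ slope_between n f (snd p / fst p ^ n).

Lemma slope_between_convex (n : nat) (f : R -> R) (z1 z z2 : R) :
  slope_between n f z1 -> slope_between n f z2 -> z1 <= z <= z2 \/ z2 <= z <= z1 ->
  slope_between n f z.
Proof.
  intros [x1 [x2 [P1 [P2 H]]]] [x3 [x4 [P3 [P4 H']]]] [Hz|Hz].
  - exists x1, x4; repeat split; auto; lra.
  - exists x3, x2; repeat split; auto; lra.
Qed.

Lemma slope_between_open (n : nat) (f : R -> R) (z : R) : slope_between n f z ->
  exists d, 0 < d /\ forall z', Rabs (z' - z) < d -> slope_between n f z'.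
Proof.
  intros [x1 [x2 [P1 [P2 H]]]].
  exists (Rmin (z - slope n f x1) (slope n f x2 - z)); split; [apply Rmin_pos; lra|].
  intros z' D; apply Rabs_def2 in D.
  pose proof (Rmin_l (z - slope n f x1) (slope n f x2 - z)).
  pose proof (Rmin_r (z - slope n f x1) (slope n f x2 - z)).
  exists x1, x2; repeat split; auto; lra.
Qed.

Lemma slope_region_convex (n : nat) (f : R -> R) (x y1 y y2 : R) :
  slope_region n f (x, y1) -> slope_region n f (x, y2) -> y1 <= y <= y2 ->
  slope_region n f (x, y).
Proof.
  intros [Hx H1] [_ H2] Hy; split; auto; simpl in *.
  apply (slope_between_convex n f _ _ _ H1 H2).
  assert (x ^ n <> 0) by now apply pow_nonzero.
  unfold Rdiv; destruct (Rlt_le_dec 0 (/ x ^ n)); [left|right]; split; nra.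
Qed.

Lemma slope_region_open_fst (n : nat) (f : R -> R) (x y : R) : slope_region n f (x, y) ->
  exists d, 0 < d /\ forall x', Rabs (x' - x) < d -> slope_region n f (x', y).
Proof.
  intros [Hx H]; simpl in *.
  destruct (slope_between_open n f _ H) as [d [Hd D]].
  assert (C : continuity_pt (fun t => y / t ^ n) x).
  { apply (continuity_pt_div (fun _ => y) (fun t => t ^ n)).
    - apply continuity_const; intros ? ?; reflexivity.
    - apply pow_continuity.
    - now apply pow_nonzero. }
  destruct (continuity_eps _ x d C Hd) as [d' [Hd' D']].
  exists (Rmin d' (Rabs x)); split; [apply Rmin_pos; auto; now apply Rabs_pos_lt|].
  pose proof (Rmin_l d' (Rabs x)); pose proof (Rmin_r d' (Rabs x)).
  intros x' L; split; simpl.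
  - intros ->; rewrite Rminus_0_l, Rabs_Ropp in L; lra.
  - apply D, D'; lra.
Qed.

(** The points [(x, y + h)] and [(x, y - h)] stay in the region under small horizontal shifts, and
    vertical convexity fills the rectangle between. *)
Lemma slope_region_open (n : nat) (f : R -> R) (p : R2) : slope_region n f p ->
  exists e, 0 < e /\ forall q, near e p q -> slope_region n f q.
Proof.
  destruct p as [x y]; intros H; assert (H' := H); destruct H' as [Hx Hs]; simpl in Hx, Hs.
  destruct (slope_between_open n f _ Hs) as [d [Hd D]].
  assert (Px : 0 < Rabs (x ^ n)) by (apply Rabs_pos_lt; now apply pow_nonzero).
  set (h := d * Rabs (x ^ n) / 2).
  assert (Hh : 0 < h).
  { unfold h; assert (0 < d * Rabs (x ^ n)) by (apply Rmult_lt_0_compat; lra); lra. }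
  assert (V : forall k, Rabs k <= h -> slope_region n f (x, y + k)).
  { intros k Hk; split; simpl; auto; apply D.
    replace ((y + k) / x ^ n - y / x ^ n) with (k / x ^ n) by (field; now apply pow_nonzero).
    unfold Rdiv; rewrite Rabs_mult, Rabs_inv.
    apply Rmult_lt_reg_r with (Rabs (x ^ n)); auto.
    rewrite Rmult_assoc, Rinv_l, Rmult_1_r by lra; unfold h in Hk, Hh; lra. }
  destruct (slope_region_open_fst n f x (y + h)) as [d1 [Hd1 D1]];
    [apply V; rewrite Rabs_right; lra|].
  destruct (slope_region_open_fst n f x (y + - h)) as [d2 [Hd2 D2]];
    [apply V; rewrite Rabs_Ropp, Rabs_right; lra|].
  exists (Rmin h (Rmin d1 d2)); split; [repeat apply Rmin_pos; lra|].
  pose proof (Rmin_l h (Rmin d1 d2)); pose proof (Rmin_r h (Rmin d1 d2)).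
  pose proof (Rmin_l d1 d2); pose proof (Rmin_r d1 d2).
  intros [x' y'] [L1 L2]; simpl in *; rewrite Rabs_minus_sym in L1; apply Rabs_def2 in L2.
  apply slope_region_convex with (y + - h) (y + h); [apply D2|apply D1|]; lra.
Qed.

(** Some slope is close to [z = y / x ^ n], and it is attained again at abscissae arbitrarily close
    to [x]. *)
Lemma slope_region_closure (n : nat) (f : R -> R) (p : R2) : n_monomial n f ->
  slope_region n f p -> closure2 (graph f) p.
Proof.
  destruct p as [x y]; intros H [Hx [x1 [x2 [P1 [P2 Hz]]]]]; simpl in *.
  set (z := y / x ^ n) in *.
  assert (Ey : y = z * x ^ n) by (unfold z; field; now apply pow_nonzero).
  apply closure2_near; intros e He.
  (* The error splits into [(slope - z) * x' ^ n], controlled by [k], and [z * (x' ^ n - x ^ n)],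
     controlled by [h]; each gets half of [e]. *)
  set (h := Rmin 1 (e / (2 * (Rabs z + 1)))).
  assert (Pz := Rabs_pos z).
  assert (Hh : 0 < h) by (apply Rmin_pos; [lra | apply Rdiv_lt_0_compat; lra]).
  assert (h1 : h <= 1) by apply Rmin_l.
  assert (h2 : h * (Rabs z + 1) <= e / 2).
  { apply Rle_trans with (e / (2 * (Rabs z + 1)) * (Rabs z + 1)).
    - apply Rmult_le_compat_r; [lra | apply Rmin_r].
    - right; field; lra. }
  destruct (continuity_eps _ x h (pow_continuity n x) Hh) as [d [Hd D]].
  assert (Px := Rabs_pos (x ^ n)).
  set (k := e / (2 * (Rabs (x ^ n) + 1))).
  assert (Hk : 0 < k) by (apply Rdiv_lt_0_compat; lra).
  destruct (slope_intermediate n f x1 x2 z k H P1 P2 Hz Hk) as [x3 [P3 D3]].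
  set (d' := Rmin (Rmin d e) (Rabs x)).
  assert (Hd' : 0 < d') by (repeat apply Rmin_pos; auto; now apply Rabs_pos_lt).
  assert (L1 : d' <= Rmin d e) by apply Rmin_l.
  assert (L2 : d' <= Rabs x) by apply Rmin_r.
  pose proof (Rmin_l d e); pose proof (Rmin_r d e).
  destruct (slope_dense_domain n f x3 (x - d') (x + d') H P3) as [x' [Hx' [Nx' E]]]; [lra| |].
  { unfold Rabs in L2; destruct (Rcase_abs x); lra. }
  exists (x', f x'); split; [reflexivity|].
  split; simpl; [apply Rabs_def1; lra|].
  assert (D' := D x' ltac:(apply Rabs_def1; lra)); simpl in D'.
  rewrite (slope_spec n f x' Nx'), E, Ey.
  rewrite Rabs_minus_sym.
  replace (slope n f x3 * x' ^ n - z * x ^ n) with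
    ((slope n f x3 - z) * x' ^ n + z * (x' ^ n - x ^ n)) by ring.
  eapply Rle_lt_trans; [apply Rabs_triang|]; rewrite !Rabs_mult.
  assert (B1 : Rabs (x' ^ n) <= Rabs (x ^ n) + 1).
  { pose proof (Rabs_triang_inv (x' ^ n) (x ^ n)); lra. }
  assert (B2 : Rabs (slope n f x3 - z) * Rabs (x' ^ n) < e / 2).
  { apply Rle_lt_trans with (Rabs (slope n f x3 - z) * (Rabs (x ^ n) + 1)).
    - apply Rmult_le_compat_l; [apply Rabs_pos | assumption].
    - replace (e / 2) with (k * (Rabs (x ^ n) + 1)) by (unfold k; field; lra).
      apply Rmult_lt_compat_r; lra. }
  assert (B3 : Rabs z * Rabs (x' ^ n - x ^ n) <= h * (Rabs z + 1)).
  { rewrite (Rmult_comm h); apply Rmult_le_compat; try lra; apply Rabs_pos. }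
  lra.
Qed.

Lemma slope_region_interior (n : nat) (f : R -> R) (p : R2) : n_monomial n f ->
  slope_region n f p -> interior2 (closure2 (graph f)) p.
Proof.
  intros H Hp; apply interior2_near.
  destruct (slope_region_open n f p Hp) as [e [He E]]; exists e; split; auto.
  intros q Hq; apply (slope_region_closure n f q H); auto.
Qed.

(** The slope at [x] might be extreme, leaving [(x, f x)] outside the region. Moving it by a small
    fraction [t] of the way towards a different slope makes both inequalities strict. *)
Lemma slope_region_near_graph (n : nat) (f : R -> R) (x e : R) : n_monomial n f ->
  (1 <= n)%nat -> ~ continuity f -> x <> 0 -> 0 < e ->
  exists y, Rabs (f x - y) < e /\ slope_region n f (x, y).
Proof.
  intros H Hn NC Hx He.
  assert (exists x1, 0 < x1 /\ slope n f x1 = slope n f x) as [x1 [P1 E1]].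
  { destruct (Rlt_le_dec 0 x); [now exists x|].
    exists (- x); split; [lra | now apply slope_opp]. }
  destruct (slope_unbounded n f H Hn NC (Rabs (slope n f x))) as [x2 [P2 L2]].
  set (g := slope n f x) in *; set (k := slope n f x2 - g).
  assert (Nk : slope n f x2 <> g) by (intro E; rewrite E in L2; lra).
  assert (Pk := Rabs_pos (k * x ^ n)).
  set (t := Rmin (1 / 2) (e / (2 * (Rabs (k * x ^ n) + 1)))).
  assert (Ht : 0 < t) by (apply Rmin_pos; [lra | apply Rdiv_lt_0_compat; lra]).
  assert (t1 : t <= 1 / 2) by apply Rmin_l.
  assert (t2 : t * (Rabs (k * x ^ n) + 1) <= e / 2).
  { apply Rle_trans with (e / (2 * (Rabs (k * x ^ n) + 1)) * (Rabs (k * x ^ n) + 1)).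
    - apply Rmult_le_compat_r; [lra | apply Rmin_r].
    - right; field; lra. }
  exists ((g + t * k) * x ^ n); split.
  - rewrite (slope_spec n f x Hx); fold g.
    replace (g * x ^ n - (g + t * k) * x ^ n) with (- (t * (k * x ^ n))) by ring.
    rewrite Rabs_Ropp, Rabs_mult, (Rabs_right t) by lra; lra.
  - split; simpl; auto.
    replace ((g + t * k) * x ^ n / x ^ n) with (g + t * k) by (field; now apply pow_nonzero).
    unfold k in *; destruct (Rlt_le_dec g (slope n f x2)).
    + exists x1, x2; repeat split; auto; [rewrite E1|]; nra.
    + exists x2, x1; repeat split; auto; [|rewrite E1]; nra.
Qed.

Lemma slope_unbounded_side (n : nat) (f : R -> R) : n_monomial n f -> (1 <= n)%nat ->
  ~ continuity f -> exists s, (s = 1 \/ s = -1) /\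
    forall C, exists x, 0 < x /\ C < s * slope n f x.
Proof.
  intros H Hn NC.
  destruct (classic (forall C, exists x, 0 < x /\ C < 1 * slope n f x)) as [U|U];
    [exists 1; auto|].
  exists (-1); split; auto; intro C; apply NNPP; intro N.
  apply not_all_ex_not in U; destruct U as [C' U].
  destruct (slope_unbounded n f H Hn NC (Rmax C C')) as [x [Px L]].
  pose proof (Rmax_l C C'); pose proof (Rmax_r C C').
  unfold Rabs in L; destruct (Rcase_abs (slope n f x)).
  - apply N; exists x; split; auto; lra.
  - apply U; exists x; split; auto; lra.
Qed.

(** On one side of 0 the power [x ^ n] has a fixed sign [k], so slopes large in one direction give
    values of [f] large in one direction. *)
Lemma monomial_unbounded_side (n : nat) (f : R -> R) (a b : R) : n_monomial n f ->
  (1 <= n)%nat -> ~ continuity f -> 0 <= a \/ b <= 0 -> exists s, (s = 1 \/ s = -1) /\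
    forall l r C, a <= l -> l < r -> r <= b -> exists x, l < x < r /\ C < s * f x.
Proof.
  intros H Hn NC Hab.
  destruct (slope_unbounded_side n f H Hn NC) as [s [Hs U]].
  assert (exists k, (k = 1 \/ k = -1) /\ forall x, a < x < b -> k * x ^ n = Rabs x ^ n) as [k [Hk K]].
  { destruct Hab as [Ha|Hb].
    - exists 1; split; auto; intros x Hx; rewrite Rabs_right; lra.
    - exists ((-1) ^ n); split.
      + clear; induction n as [|n IH]; simpl; [now left | destruct IH as [->| ->]; lra].
      + intros x Hx; rewrite Rabs_left, <- Rpow_mult_distr by lra; f_equal; ring. }
  exists (s * k); split; [destruct Hs, Hk; subst; lra|].
  intros l r C Hl Hlr Hr.
  (* Staying [d] inside the interval keeps [Rabs x] at least [d], because the interval does not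
     cross 0. *)
  set (d := (r - l) / 3).
  assert (Pd : 0 < d ^ n) by (apply pow_lt; unfold d; lra).
  destruct (U ((Rabs C + 1) / d ^ n)) as [x1 [P1 L1]].
  destruct (slope_dense_domain n f x1 (l + d) (r - d) H P1) as [x [Hx [Nx E]]];
    [unfold d; lra|unfold d; lra|].
  exists x; split; [unfold d in *; lra|].
  assert (Ex : s * k * f x = s * slope n f x * Rabs x ^ n).
  { rewrite (slope_spec n f x Nx) at 1; rewrite <- K by (unfold d in *; lra); ring. }
  assert (Dx : d ^ n <= Rabs x ^ n).
  { apply pow_incr; split; [unfold d; lra|].
    unfold Rabs, d in *; destruct (Rcase_abs x); lra. }
  rewrite Ex, E.
  assert (PC := Rabs_pos C); pose proof (Rle_abs C).
  assert (0 < (Rabs C + 1) / d ^ n) by (apply Rdiv_lt_0_compat; lra).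
  apply Rlt_le_trans with ((Rabs C + 1) / d ^ n * d ^ n).
  - replace ((Rabs C + 1) / d ^ n * d ^ n) with (Rabs C + 1) by (field; lra); lra.
  - apply Rmult_le_compat; lra.
Qed.

(** * Locally constant properties of points of the graph *)

Lemma graph_locally_constant_spreads (n : nat) (f : R -> R) (P : R -> Prop) (x : R) :
  n_monomial n f -> (1 <= n)%nat -> ~ continuity f ->
  (forall K : set2, continuum K -> (forall p, K p -> interior2 (closure2 (graph f)) p) ->
     touches_two_vertical_lines K -> exists p, graph f p /\ K p) ->
  (forall x, exists e, 0 < e /\ forall x', near e (x, f x) (x', f x') -> (P x <-> P x')) ->
  x <> 0 -> P x -> exists d, 0 < d /\ forall x', Rabs (x - x') < d -> P x'.
Proof.
  intros H Hn NC HK Loc Hx Px.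
  set (A := closure2 (fun p => graph f p /\ P (fst p))).
  set (B := closure2 (fun p => graph f p /\ ~ P (fst p))).
  assert (CA : closed2 A) by apply closure2_closed.
  assert (CB : closed2 B) by apply closure2_closed.
  assert (AB : forall p, closure2 (graph f) p -> A p \/ B p).
  { intros p Hp; apply (closed2_union A B CA CB); intros e He.
    destruct (proj1 (closure2_near _ _) Hp e He) as [q [G N]]; exists q; split; auto.
    destruct (classic (P (fst q))); [left | right]; apply closure2_near; intros e' He';
      exists q; split; auto; now apply near_refl. }
  assert (NA : forall x y e z, ~ P x ->
    (forall x', near e (x, f x) (x', f x') -> (P x <-> P x')) ->
    near (e / 2) (x, f x) (z, y) -> ~ A (z, y)).
  { intros x0 y e z Nx E N HA.
    assert (He : 0 < e).
    { destruct N as [N _]; pose proof (Rabs_pos (fst (x0, f x0) - fst (z, y))); lra. }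
    destruct (proj1 (closure2_near _ _) HA (e / 2)) as [[x' y'] [[G Q] N']]; [lra|].
    unfold graph in G; simpl in G, Q; subst y'; apply Nx, (E x'); auto.
    replace e with (e / 2 + e / 2) by field; now apply near_trans with (z, y). }
  assert (NB : forall x y e z, P x ->
    (forall x', near e (x, f x) (x', f x') -> (P x <-> P x')) ->
    near (e / 2) (x, f x) (z, y) -> ~ B (z, y)).
  { intros x0 y e z Qx E N HB.
    assert (He : 0 < e).
    { destruct N as [N _]; pose proof (Rabs_pos (fst (x0, f x0) - fst (z, y))); lra. }
    destruct (proj1 (closure2_near _ _) HB (e / 2)) as [[x' y'] [[G Q] N']]; [lra|].
    unfold graph in G; simpl in G, Q; subst y'; apply Q, (E x'); auto.
    replace e with (e / 2 + e / 2) by field; now apply near_trans with (z, y). }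
  (* A graph point in both [A] and [B] would have graph points with and without [P] arbitrarily
     near, against [Loc]. *)
  assert (NoK : forall K, continuum K -> touches_two_vertical_lines K ->
    (forall p, K p -> slope_region n f p /\ A p /\ B p) -> False).
  { intros K CK TK RK; destruct (HK K CK) as [[z y] [G Kz]]; auto.
    - intros p Kp; apply (slope_region_interior n f p H), RK, Kp.
    - unfold graph in G; simpl in G; subst y; destruct (RK _ Kz) as [_ [Az Bz]].
      destruct (Loc z) as [e [He E]].
      assert (N : near (e / 2) (z, f z) (z, f z)) by (apply near_refl; lra).
      destruct (classic (P z)); [now apply (NB z (f z) e z) | now apply (NA z (f z) e z)]. }
  destruct (Loc x) as [e [He E]].
  destruct (slope_region_near_graph n f x (e / 2) H Hn NC Hx) as [yb [Db Rb]]; [lra|].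
  destruct (slope_region_open_fst n f x yb Rb) as [e1 [He1 E1]].
  (* Over all abscissae within [d] of [x], the height [yb] stays in the region and outside [B]. *)
  set (d := Rmin (e / 2) e1).
  assert (Hd : 0 < d) by (apply Rmin_pos; lra).
  assert (d1 : d <= e / 2) by apply Rmin_l; assert (d2 : d <= e1) by apply Rmin_r.
  exists d; split; auto; intros x' Hx'; apply NNPP; intro Nx'.
  assert (Nx0 : x' <> 0) by (apply (E1 x'); rewrite Rabs_minus_sym; lra).
  destruct (Loc x') as [e' [He' E']].
  destruct (slope_region_near_graph n f x' (e' / 2) H Hn NC Nx0) as [yt [Dt Rt]]; [lra|].
  destruct (slope_region_open_fst n f x' yt Rt) as [e2 [He2 E2]].
  (* The interval of radius [h] around [x'] stays within [d] of [x], where [yb] serves, and is short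
     enough for [yt] to stay in the region and outside [A]. *)
  set (h := Rmin ((d - Rabs (x - x')) / 2) (Rmin (e2 / 2) (e' / 4))).
  assert (Hh : 0 < h) by (repeat apply Rmin_pos; lra).
  assert (h1 : h <= (d - Rabs (x - x')) / 2) by apply Rmin_l.
  assert (h23 : h <= Rmin (e2 / 2) (e' / 4)) by apply Rmin_r.
  pose proof (Rmin_l (e2 / 2) (e' / 4)); pose proof (Rmin_r (e2 / 2) (e' / 4)).
  assert (Near : forall z, x' - h <= z <= x' + h -> Rabs (x - z) < d /\ Rabs (z - x') <= h).
  { intros z Hz; assert (Rabs (z - x') <= h) by (apply Rabs_le; lra); split; auto.
    pose proof (Rabs_triang (x - x') (x' - z)); rewrite (Rabs_minus_sym x' z) in *.
    replace (x - x' + (x' - z)) with (x - z) in * by ring; lra. }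
  assert (Bot : forall z, x' - h <= z <= x' + h -> slope_region n f (z, yb) /\ ~ B (z, yb)).
  { intros z Hz; destruct (Near z Hz); split.
    - apply E1; rewrite Rabs_minus_sym; lra.
    - apply (NB x yb e z Px E); split; simpl; lra. }
  assert (Top : forall z, x' - h <= z <= x' + h -> slope_region n f (z, yt) /\ ~ A (z, yt)).
  { intros z Hz; destruct (Near z Hz); split.
    - apply E2; lra.
    - apply (NA x' yt e' z Nx' E'); split; simpl; [rewrite Rabs_minus_sym|]; lra. }
  (* If [yt] is the lower height, [A] and [B] exchange roles; if the heights agree, one point would
     escape both sets although the graph is dense there. *)
  destruct (Rtotal_order yb yt) as [L|[L|L]].
  - assert (Reg : forall p, rect (x' - h) (x' + h) yb yt p -> slope_region n f p).
    { intros [z y] [Z1 Z2]; apply slope_region_convex with yb yt; auto; [apply Bot | apply Top]; auto. }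
    destruct (crossing_continuum A B (x' - h) (x' + h) yb yt) as [K [CK [TK RK]]]; auto; try lra.
    + intros p Hp; apply AB, (slope_region_closure n f p H), Reg, Hp.
    + intros z Hz; apply Bot, Hz.
    + intros z Hz; apply Top, Hz.
    + apply (NoK K CK TK); intros p Kp; destruct (RK p Kp) as [? ?]; auto.
  - subst yt; destruct (Bot x') as [R1 N1]; [lra|]; destruct (Top x') as [_ N2]; [lra|].
    destruct (AB (x', yb)); auto; now apply (slope_region_closure n f).
  - assert (Reg : forall p, rect (x' - h) (x' + h) yt yb p -> slope_region n f p).
    { intros [z y] [Z1 Z2]; apply slope_region_convex with yt yb; auto; [apply Top | apply Bot]; auto. }
    destruct (crossing_continuum B A (x' - h) (x' + h) yt yb) as [K [CK [TK RK]]]; auto; try lra.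
    + intros p Hp; apply or_comm, AB, (slope_region_closure n f p H), Reg, Hp.
    + intros z Hz; apply Top, Hz.
    + intros z Hz; apply Bot, Hz.
    + apply (NoK K CK TK); intros p Kp; destruct (RK p Kp) as [? [? ?]]; auto.
Qed.

Lemma graph_locally_constant_global (n : nat) (f : R -> R) (P : R -> Prop) :
  n_monomial n f -> (1 <= n)%nat -> ~ continuity f ->
  (forall K : set2, continuum K -> (forall p, K p -> interior2 (closure2 (graph f)) p) ->
     touches_two_vertical_lines K -> exists p, graph f p /\ K p) ->
  (forall x, exists e, 0 < e /\ forall x', near e (x, f x) (x', f x') -> (P x <-> P x')) ->
  forall x, P x <-> P 0.
Proof.
  intros H Hn NC HK Loc.
  assert (Loc' : forall x, x <> 0 -> exists d, 0 < d /\
    forall x', Rabs (x - x') < d -> (P x <-> P x')).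
  { intros x Hx; destruct (classic (P x)) as [Px|Px].
    - destruct (graph_locally_constant_spreads n f P x H Hn NC HK Loc Hx Px) as [d [Hd D]].
      exists d; split; auto; intros x' L; specialize (D x' L); tauto.
    - destruct (graph_locally_constant_spreads n f (fun x => ~ P x) x H Hn NC HK) as [d [Hd D]]; auto.
      + intro z; destruct (Loc z) as [e [He E]]; exists e; split; auto.
        intros x' L; specialize (E x' L); tauto.
      + exists d; split; auto; intros x' L; specialize (D x' L); tauto. }
  assert (Seg : forall a b, a <= b -> 0 < a \/ b < 0 -> (P a <-> P b)).
  { intros a b Hab H0; apply segment_connected; auto.
    intros x Hx; destruct (Loc' x) as [d [Hd D]]; [lra|]; exists d; split; auto. }
  assert (f0 : f 0 = 0) by now apply (monomial_0 n).
  destruct (Loc 0) as [e [He E]].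
  intro x; destruct (Req_dec x 0) as [->|Nx]; [tauto|].
  (* A fraction [q < m] puts [q * x] within [e] of 0, and also [q ^ n * f x], since [q <= 1] gives
     [q ^ n <= q]. *)
  set (m := Rmin 1 (Rmin (e / (Rabs x + 1)) (e / (Rabs (f x) + 1)))).
  assert (Ax := Rabs_pos x); assert (Af := Rabs_pos (f x)).
  assert (Pm : 0 < m) by (repeat apply Rmin_pos; try apply Rdiv_lt_0_compat; lra).
  assert (m1 : m <= 1) by apply Rmin_l.
  assert (m23 : m <= Rmin (e / (Rabs x + 1)) (e / (Rabs (f x) + 1))) by apply Rmin_r.
  pose proof (Rmin_l (e / (Rabs x + 1)) (e / (Rabs (f x) + 1))).
  pose proof (Rmin_r (e / (Rabs x + 1)) (e / (Rabs (f x) + 1))).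
  destruct (fraction_dense 0 m) as [a [b [Ha [Hb Hq]]]]; [lra|lra|].
  assert (Eq := monomial_fraction n a b f x H Hb).
  set (q := INR a / INR b) in *.
  assert (Sm : forall v, 0 <= v -> m <= e / (v + 1) -> q * v < e).
  { intros v Hv L.
    assert (q * (v + 1) < e / (v + 1) * (v + 1)) by (apply Rmult_lt_compat_r; lra).
    replace (e / (v + 1) * (v + 1)) with e in * by (field; lra); lra. }
  assert (P 0 <-> P (q * x)) as ->.
  { apply E; rewrite f0; split; simpl; rewrite Rminus_0_l, Rabs_Ropp.
    - rewrite Rabs_mult, (Rabs_right q) by lra; apply Sm; lra.
    - rewrite Eq, Rabs_mult.
      apply Rle_lt_trans with (q * Rabs (f x)); [|apply Sm; lra].
      apply Rmult_le_compat_r; auto.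
      rewrite Rabs_right by (apply Rle_ge, pow_le; lra).
      destruct n as [|n]; [lia|]; simpl; rewrite <- (Rmult_1_r q) at 3.
      apply Rmult_le_compat_l; [lra|]; rewrite <- (pow1 n); apply pow_incr; lra. }
  destruct (Rlt_le_dec 0 x).
  - assert (0 < q * x) by (apply Rmult_lt_0_compat; lra).
    symmetry; apply Seg; auto; nra.
  - apply Seg; [nra|right; nra].
Qed.

Theorem theorem5 (n : nat) (f : R -> R) :
  (1 <= n)%nat ->
  n_monomial n f ->
  ~ continuity f ->
  (connected2 (graph f) <->
   forall K : set2,
     continuum K ->
     (forall p, K p -> interior2 (closure2 (graph f)) p) ->
     touches_two_vertical_lines K ->
     exists p, graph f p /\ K p).
Proof.
  intros Hn H NC; split.
  - intros CG K [CpK [CK _]] IK [u0 [v0 [Ku0 [Kv0 Huv0]]]].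
    apply NNPP; intro N.
    assert (exists u v, K u /\ K v /\ fst u < fst v) as [u [v [Ku [Kv Huv]]]].
    { destruct (Rlt_le_dec (fst u0) (fst v0)); [now exists u0, v0|].
      exists v0, u0; repeat split; auto; lra. }
    (* The strip has to lie on one side of 0 for the graph to be unbounded in a single direction
       throughout it. *)
    assert (exists a b, fst u <= a /\ a < b /\ b <= fst v /\ (0 <= a \/ b <= 0))
      as [a [b [Ha [Hab [Hb H0]]]]].
    { destruct (Rlt_le_dec 0 (fst v)).
      - exists (Rmax (fst u) 0), (fst v).
        pose proof (Rmax_l (fst u) 0); pose proof (Rmax_r (fst u) 0).
        repeat split; auto; [apply Rmax_lub_lt|]; lra.
      - exists (fst u), (fst v); repeat split; lra. }
    destruct (monomial_unbounded_side n f a b H Hn NC H0) as [s [Hs U]].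
    apply (barrier_disconnects f K a b s u v); auto.
    intros p G Kp; apply N; now exists p.
  - intros HK [U [V [HU [HV [Cov [[p [Gp Up]] [[q [Gq Vq]] Dis]]]]]]].
    assert (Gx : forall x, graph f (x, f x)) by (intro; reflexivity).
    (* Membership in [U] is locally constant along the graph: near a point of [V] the graph stays in
       [V], hence out of [U]. *)
    assert (C : forall x, U (x, f x) <-> U (0, f 0)).
    { apply (graph_locally_constant_global n f (fun x => U (x, f x)) H Hn NC HK).
      intro x; destruct (Cov (x, f x) (Gx x)) as [Ux|Vx].
      - destruct (proj1 (open2_near _) HU _ Ux) as [e [He E]]; exists e; split; auto.
        intros x' Nx; specialize (E _ Nx); tauto.
      - destruct (proj1 (open2_near _) HV _ Vx) as [e [He E]]; exists e; split; auto.
        intros x' Nx; specialize (E _ Nx).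
        split; intro; [elim (Dis (x, f x)) | elim (Dis (x', f x'))]; auto. }
    destruct p as [xp yp], q as [xq yq]; unfold graph in Gp, Gq; simpl in Gp, Gq; subst.
    apply (Dis (xq, f xq)); auto; now apply C, (C xp).
Qed.
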